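(* Let $G$ be a connected graph on $n$ vertices and let $t\geq 3$ be an integer. Let $J_t(G)$ denote the Alexander dual of the $t$-connected ideal of $G$. Then the following statements are equivalent: (1) $J_t(G)$ satisfies the packing property; (2) $J_t(G)^{(s)}=J_t(G)^s$ for all $s\geq 1$; (3) one of the following holds: (a) $n=t$; (b) $G=P_n$ for some $n\geq t$; (c) $G=C_n$ and one of the following holds: (i) $t=3$ and $n\in\{3,6,9\}$; (ii) $t=4$ and $n\in\{4,8\}$; (iii) $t\geq 5$ and $n=t$.
   Context: Let $\mathbb{K}$ be a field. Graphs are simple; $G$ has vertex set $V(G)=\{x_1,\dots,x_n\}$, and $R=\mathbb{K}[x_1,\dots,x_n]$. For $t\ge 2$, the $t$-connected ideal of $G$ is the square-free monomial ideal $I_t(G)=\langle x_{i_1}\cdots x_{i_t} : G[\{x_{i_1},\dots,x_{i_t}\}]\text{ is connected}\rangle\subseteq R$, the generators running over $t$-element vertex subsets, where $G[S]$ is the induced subgraph on $S$. The Alexander dual of a square-free monomial ideal $I$ with minimal monomial generators $m_1,\dots,m_k$ is $I^\vee=\bigcap_{i=1}^k\langle x_j : x_j\mid m_i\rangle$. Write $J_t(G)=I_t(G)^\vee$. Symbolic powers: for an ideal $I$, $I^{(s)}=\bigcap_{\mathfrak p\in\mathrm{Ass}(I)}(I^sR_{\mathfrak p}\cap R)$; for a square-free monomial ideal with primary decomposition $I=P_1\cap\dots\cap P_k$ this equals $P_1^s\cap\dots\cap P_k^s$. Packing property: a square-free monomial ideal $I$ of height $c$ is König if there exists a regular sequence of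 monomials in $I$ of length $c$. $I$ has the packing property if every ideal obtained from $I$ by setting any number of variables equal to $0$ or $1$ is König. $P_n$ is the path on $n$ vertices (edges $x_ix_{i+1}$, $1\le i\le n-1$), and $C_n$ is the cycle on $n$ vertices (edges $x_ix_{i+1}$, $1\le i\le n-1$, and $x_1x_n$). *)

(* Defs.v *)
From HB Require Import structures.
From mathcomp Require Import all_boot all_order all_algebra.
From mathcomp Require Import boolp classical_sets.
From mathcomp Require Import mpoly.

Set Implicit Arguments.
Unset Strict Implicit.
Unset Printing Implicit Defensive.

Import GRing.Theory.
Local Open Scope classical_set_scope.
Local Open Scope ring_scope.

(* An ideal of a commutative ring is represented by its set of elements. *)

Definition gen_ideal (R : comNzRingType) (S : set R) : set R :=
  [set f | exists k (a b : 'I_k -> R),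
     (forall i, S (b i)) /\ f = \sum_i a i * b i].

Definition ideal_pow (R : comNzRingType) (I : set R) (s : nat) : set R :=
  gen_ideal [set f | exists2 h : 'I_s -> R,
     forall i, I (h i) & f = \prod_i h i].

(* [idealr_closed] already forces P to be a proper ideal. *)
Definition prime_ideal (R : comNzRingType) (P : set R) : Prop :=
  idealr_closed (mem P) /\ prime_idealr_closed (mem P).

(* Ass(R/I): the primes of the form (I : f). *)
Definition assoc_primes (R : comNzRingType) (I : set R) : set (set R) :=
  [set P | prime_ideal P /\ exists f, P = [set g | I (g * f)]].

(* The ideal I R_P of the localization R_P, inside the fraction field of R. *)
Definition localized_ideal (R : idomainType) (I P : set R) :
    set {fraction R} :=
  [set z | exists a u : R, [/\ I a, ~ P u & z = FracField.tofrac a / FracField.tofrac u]].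

Definition symbolic_pow (R : idomainType) (I : set R) (s : nat) : set R :=
  \bigcap_(P in assoc_primes I)
     (@FracField.tofrac R @^-1` localized_ideal (ideal_pow I s) P).

Definition prime_chain (R : comNzRingType) (P : set R) (c : nat) : Prop :=
  exists q : nat -> set R,
    [/\ forall i, (i <= c)%N -> prime_ideal (q i),
        forall i, (i < c)%N -> q i `<` q i.+1 & q c = P].

Definition prime_height (R : comNzRingType) (P : set R) (c : nat) : Prop :=
  prime_chain P c /\ forall d, prime_chain P d -> (d <= c)%N.

(* The unit ideal, being contained in no prime, has no finite height. *)
Definition height (R : comNzRingType) (I : set R) (c : nat) : Prop :=
  (exists P, [/\ prime_ideal P, I `<=` P & prime_height P c]) /\
  (forall P d, prime_ideal P -> I `<=` P -> prime_height P d -> (c <= d)%N).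

Definition regular_sequence (R : comNzRingType) (s : seq R) : Prop :=
  (forall i g, (i < size s)%N ->
     gen_ideal [set` take i s] (g * s`_i) -> gen_ideal [set` take i s] g) /\
  ~ gen_ideal [set` s] 1.

(* The unit ideal counts as Konig (it has no finite height); otherwise no
   nonzero monomial ideal would have the packing property, since setting all
   variables to 1 yields the unit ideal. *)
Definition konig (K : fieldType) (n : nat) (I : set {mpoly K[n]}) : Prop :=
  forall c, height I c -> exists s : seq 'X_{1..n},
    [/\ size s = c, forall m, m \in s -> I 'X_[m] &
        regular_sequence [seq 'X_[K, m] | m <- s]].

(* [v i = Some b] sets x_i to b, [v i = None] leaves x_i unchanged.  The result
   is viewed as an ideal of the original polynomial ring. *)
Definition set_vars (K : fieldType) (n : nat) (v : 'I_n -> option bool)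
    (I : set {mpoly K[n]}) : set {mpoly K[n]} :=
  gen_ideal
    (comp_mpoly [tuple if v i is Some b then b%:R else 'X_i | i < n] @` I).

Definition packing_property (K : fieldType) (n : nat)
    (I : set {mpoly K[n]}) : Prop :=
  forall v : 'I_n -> option bool, konig (set_vars v I).

(* For a monomial ideal I, these are its minimal monomial generators. *)
Definition min_monomials (K : fieldType) (n : nat)
    (I : set {mpoly K[n]}) : set 'X_{1..n} :=
  [set m | I 'X_[m] /\
     forall m' : 'X_{1..n}, I 'X_[m'] -> (m' <= m)%MM -> m' = m].

Definition alexander_dual (K : fieldType) (n : nat)
    (I : set {mpoly K[n]}) : set {mpoly K[n]} :=
  \bigcap_(m in min_monomials I)
     gen_ideal [set f | exists2 j : 'I_n, (0 < m j)%N & f = 'X_j].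

Definition induced (V : finType) (G : rel V) (S : {set V}) : rel V :=
  [rel x y in S | G x y].

Definition induced_connected (V : finType) (G : rel V) (S : {set V}) : Prop :=
  S != finset.set0 /\ {in S &, forall x y, connect (induced G S) x y}.

Definition connected_graph (V : finType) (G : rel V) : Prop :=
  induced_connected G [set: V]%SET.

Definition t_connected_ideal (K : fieldType) (n t : nat) (G : rel 'I_n) :
    set {mpoly K[n]} :=
  gen_ideal [set f | exists S : {set 'I_n},
     [/\ #|S| = t, induced_connected G S & f = \prod_(i in S) 'X_i]].
Arguments t_connected_ideal K {n} t G.

Definition J (K : fieldType) (n t : nat) (G : rel 'I_n) : set {mpoly K[n]} :=
  alexander_dual (t_connected_ideal K t G).
Arguments J K {n} t G.

Definition graph_iso (V W : finType) (G : rel V) (H : rel W) : Prop :=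
  exists2 f : V -> W, bijective f & {mono f : x y / G x y >-> H x y}.

Definition path_graph (n : nat) : rel 'I_n :=
  fun x y => (x.+1 == y :> nat) || (y.+1 == x :> nat).
Arguments path_graph n : clear implicits.

(* The n-cycle, for n >= 3. *)
Definition cycle_graph (n : nat) : rel 'I_n :=
  fun x y => [|| path_graph n x y, (x == 0%N :> nat) && (y.+1 == n)
               | (y == 0%N :> nat) && (x.+1 == n)].
Arguments cycle_graph n : clear implicits.

(* Main.v *)
(* Write H for the hypergraph of connected t-subsets of G.  A monomial lies in
   J_t(G) iff its support meets every edge of H, and the symbolic power J^(s) is
   spanned by the monomials of degree at least s on every edge.  Hence (2) says
   that every weight function with weight at least s on each edge dominates a sum
   of s covers (H is Mengerian), and (1) says that every minor of H whose smallest
   edge has size c has c disjoint covers; applied to a weight with values 0, 1, c,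
   the first property gives the second.  The height of an ideal generated by
   variables comes from dim K[x_1..x_n] <= n: n + 1 polynomials satisfy a relation,
   and dividing it by its lowest monomial contradicts a longer chain of primes.

   If (1) holds and n > t, then J itself is Konig: the vertices have a t-colouring
   in which every edge is rainbow.  This forces all degrees to be at most 2, so G
   is a path or a cycle, and t divides n in the latter case, say n = qt.  If
   (t - 2)q > t, keeping only the 2q + 1 vertices floor(iqt / (2q + 1)) gives a
   minor with smallest edge size 2 containing an odd cycle, so it is not Konig.
   The remaining cycles are the listed ones.  Conversely the edges of a path are
   intervals, for which listing the vertices with multiplicity and colouring
   cyclically gives the decomposition, and for the cycles C_6, C_9 (t = 3) and
   C_8 (t = 4) covers are peeled off one at a time. *)
Require Import Defs.
From mathcomp Require Import mpoly.
From mathcomp Require Import all_boot all_order all_algebra.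
From mathcomp Require Import boolp zify.

Set Implicit Arguments.
Unset Strict Implicit.
Unset Printing Implicit Defensive.

(** * Packed and Mengerian clutters *)

Section Clutters.
Variable n : nat.
Implicit Types (S : {set 'I_n}) (H : {set 'I_n} -> Prop).

Definition conn_edge (t : nat) (G : rel 'I_n) S := #|S| = t /\ induced_connected G S.

(* Setting x_i = 1 (Some true) deletes the edges through i, setting x_i = 0
   (Some false) contracts i. *)
Definition minor (v : 'I_n -> option bool) H S' :=
  exists S, [/\ H S, forall i, i \in S -> v i <> Some true &
                S' = [set i in S | v i == None]].

(** Encodes c disjoint covers as colour classes; vertices of colour c or more belong to none of
    them. *)
Definition colorable H c := exists col : 'I_n -> nat,
  forall S, H S -> forall k, (k < c)%N -> exists2 i, i \in S & col i = k.

Definition packed H := forall v S, minor v H S ->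
  (forall S', minor v H S' -> (#|S| <= #|S'|)%N) -> colorable (minor v H) #|S|.

(** The max-flow min-cut property of the clutter of minimal covers of [H]: [a] gives the capacities
    and [b] packs [s] covers into them. *)
Definition mengerian H := forall s (a : 'I_n -> nat),
  (forall S, H S -> (s <= \sum_(i in S) a i)) ->
  exists b : 'I_s -> 'I_n -> nat, (forall i, (\sum_k b k i <= a i)) /\
    forall k S, H S -> exists2 i, i \in S & (0 < b k i).

Lemma mengerian_packed H : mengerian H -> packed H.
Proof.
move=> hM v S0 _ hmin.
(* Weight [#|S0|] on the deleted vertices satisfies every edge that disappears in the minor; the
   other edges keep at least [#|S0|] vertices of weight 1. *)
have [|b [hb hc]] := hM #|S0| (fun i => match v i with None => 1
    | Some true => #|S0| | Some false => 0 end).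
  move=> S HS; case: (pselect (exists2 i, i \in S & v i = Some true)) => [[i iS vi]|hno].
    by rewrite (bigD1 i) //= vi leq_addr.
  have /hmin h : minor v H [set i in S | v i == None].
    by exists S; split=> // i iS vi; apply: hno; exists i.
  apply: leq_trans h _; rewrite -sum1dep_card big_mkcondr /=; apply: leq_sum => i iS.
  by case: (v i) => [[]|].
pose c := #|S0|; rewrite -/c in b hb hc *.
(* Kept vertices have capacity 1, so each lies in at most one cover; [c] is the default for a vertex
   in none. *)
exists (fun i => if [pick k | (0 < b k i)] is Some k then k : nat else c).
move=> _ [S [HS hS ->]] k kc; have [i iS hi] := hc (Ordinal kc) S HS.
exists i.
  rewrite inE iS; have := hS i iS; have := hb i.
  rewrite (bigD1 (Ordinal kc)) //=; case: (v i) => [[]|] //=; move: hi; lia.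
case: pickP => [k' hk'|/(_ (Ordinal kc))]; last by rewrite hi.
apply/eqP/negPn/negP => ne.
have := hb i; rewrite (bigD1 (Ordinal kc)) //= (bigD1 k') /=; last first.
  by apply: contra ne => /eqP ->.
have := hS i iS; case: (v i) => [[]|] //=; move: hi hk'; lia.
Qed.

End Clutters.

(** * Connected vertex sets *)

Section ConnectedSets.
Variables (n : nat) (G : rel 'I_n).
Hypothesis G_sym : symmetric G.
Implicit Types (A S W : {set 'I_n}) (x y z : 'I_n).

Lemma connected_closed S A x : induced_connected G S -> A \subset S -> x \in A ->
  (forall a b, a \in A -> b \in S -> G a b -> b \in A) -> A = S.
Proof.
move=> [_ hS] /subsetP AS xA hA; apply/setP => y; apply/idP/idP => [/AS//|yS].
have /connectP [p hp ->] := hS x y (AS x xA) yS.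
elim: p x xA hp => [|z p IHp] x xA //= /andP [/andP [/andP [_ zS] xz] hp].
by apply: (IHp z) => //; apply: hA xz.
Qed.

Lemma connected_add S w z : induced_connected G S -> w \in S -> G w z ->
  induced_connected G (z |: S).
Proof.
move=> [_ hS] wS wz; have iS x y : x \in S -> y \in S -> connect (induced G (z |: S)) x y.
  move=> xS yS; apply: (connect_sub _ (hS x y xS yS)) => u v /andP [/andP [uS vS] uv].
  by apply: connect1; rewrite /induced /= !inE uS vS uv !orbT.
have csym : connect_sym (induced G (z |: S)).
  apply: sym_connect_sym => u v; rewrite /induced /= G_sym.
  by rewrite [(u \in _) && _]andbC.
have zw : connect (induced G (z |: S)) w z.
  by apply: connect1; rewrite /induced /= !inE wS wz eqxx !orbT.
have toz x : x \in z |: S -> connect (induced G (z |: S)) x z.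
  case/setU1P => [->//|xS]; exact: connect_trans (iS _ _ xS wS) zw.
split; first by apply/set0Pn; exists z; rewrite !inE eqxx.
move=> x y /toz hx /toz hy; apply: connect_trans hx _; by rewrite csym.
Qed.

Lemma connected1 x : induced_connected G [set x].
Proof.
split; first by apply/set0Pn; exists x; rewrite inE.
by move=> u v /set1P -> /set1P ->.
Qed.

Hypothesis G_conn : connected_graph G.

Lemma connected_grow S : induced_connected G S -> #|S| < n ->
  exists z w, [/\ z \notin S, w \in S & G w z].
Proof.
move=> [/set0Pn [x xS] _] Sn; apply: contrapT => h.
suff e : S = [set: 'I_n] by move: Sn; rewrite e cardsT card_ord ltnn.
apply: (connected_closed G_conn (subsetT _) xS) => a b aS _ ab.
by apply: contrapT => /negP bS; apply: h; exists b, a.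
Qed.

Lemma connected_extend S k : induced_connected G S -> #|S| <= k <= n ->
  exists W, [/\ S \subset W, induced_connected G W & #|W| = k].
Proof.
move=> hS /andP [Sk kn]; move: (k - #|S|) (subnKC Sk) => d.
elim: d k kn {Sk} => [|d IHd] k kn e.
  by exists S; split=> //; lia.
have [||W [SW hW Wd]] := IHd k.-1; [lia|lia|].
have [|z [w [zW wW wz]]] := connected_grow hW; first lia.
exists (z |: W); split; last by rewrite cardsU1 zW Wd; lia.
  by apply: subset_trans SW (subsetUr _ _).
exact: connected_add wz.
Qed.

Definition noncut W := [set a in W | `[< induced_connected G (W :\ a) >]].

(** The new vertex z hangs on w, so it is noncut and every noncut vertex except possibly w stays
    noncut: z makes up for the loss of w. *)
Lemma noncut_grow W z w : induced_connected G W -> z \notin W -> w \in W -> G w z ->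
  #|noncut W| <= #|noncut (z |: W)|.
Proof.
move=> hW zW wW wz.
have zN : z \in noncut (z |: W).
  rewrite !inE eqxx /=; apply/asboolP; rewrite setU1K //.
have sub : noncut W :\ w \subset noncut (z |: W) :\ z.
  apply/subsetP => a; rewrite !inE => /and3P [aw aW /asboolP ha].
  have az : a != z by apply: contraNneq zW => <-.
  rewrite az aW orbT /=; apply/asboolP.
  have -> : (z |: W) :\ a = z |: (W :\ a).
    by apply/setP => u; rewrite !inE; case: (eqVneq u z) => [->|]; rewrite ?orbT //= 1?eq_sym az.
  by apply: (connected_add ha _ wz); rewrite !inE eq_sym aw.
have := subset_leq_card sub.
rewrite (cardsD1 w (noncut W)) (cardsD1 z (noncut (z |: W))) zN => h.
by apply: leq_add => //; case: (_ \in _).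
Qed.

Variable (t : nat) (col : 'I_n -> nat).
Hypotheses (t_ge3 : 3 <= t) (t_lt_n : t < n).
Hypothesis hcol : forall S, conn_edge t G S -> forall k, k < t -> exists2 i, i \in S & col i = k.

(** Pigeonhole: t colours all occur on t vertices, so each occurs once and no other colour does. *)
Lemma rainbow S : conn_edge t G S ->
  {in S &, injective col} /\ (forall i, i \in S -> col i < t).
Proof.
move=> hS; have := hcol hS; have [cS _] := hS => hk.
have sub : {subset iota 0 t <= [seq col i | i in S]}.
  move=> k; rewrite mem_iota add0n => /= /hk [i iS <-]; exact: image_f.
have sz : size [seq col i | i in S] <= size (iota 0 t) by rewrite size_image cS size_iota.
split.
  exact/dinjectiveP/(leq_size_uniq (iota_uniq 0 t) sub sz).
move=> i iS; have [_ e] := uniq_min_size (iota_uniq 0 t) sub sz.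
by have := e (col i); rewrite mem_iota add0n /= image_f.
Qed.

(* Adding a vertex to a connected set never decreases the number of noncut
   vertices, so three of them survive until size t + 1, which is impossible:
   removing any one of them leaves a rainbow set. *)
Lemma degree_le2 x y1 y2 y3 : uniq [:: x; y1; y2; y3] -> G x y1 -> G x y2 -> G x y3 -> False.
Proof.
move=> un g1 g2 g3.
have Gx3 y y' : G x y -> G x y' -> induced_connected G [set y'; y; x].
  move=> g g'; rewrite -setUA; apply: (@connected_add _ x) => //; last by rewrite !inE eqxx orbT.
  by apply: (@connected_add _ x); rewrite ?inE //; apply: connected1.
have grow k : 4 <= k <= n -> exists W, [/\ induced_connected G W, #|W| = k & 3 <= #|noncut W|].
  elim: k => // k IHk hk; case: (ltnP k 4) => k4; last first.
    have [|W [hW Wk nW]] := IHk; first lia.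
    have [|z [w [zW wW wz]]] := connected_grow hW; first lia.
    exists (z |: W); split; first exact: connected_add wz.
      by rewrite cardsU1 zW Wk.
    exact: leq_trans nW (noncut_grow hW zW wW wz).
  (* Base case: a vertex with three neighbours, any of which can be removed without disconnecting
     the rest. *)
  have {k4 hk IHk} -> : k = 3 by lia.
  pose W := [set x; y1; y2; y3]; exists W.
  have cW : #|W| = 4.
    have -> : W = [set i in [:: x; y1; y2; y3]] by apply/setP => i; rewrite !inE !orbA.
    by rewrite cardsE (card_uniqP un).
  split=> //.
    have -> : W = y3 |: [set y2; y1; x].
      by apply/setP => i; rewrite !inE; case: (i == x); case: (i == y1);
        case: (i == y2); case: (i == y3).
    by apply: (connected_add (Gx3 _ _ g1 g2) _ g3); rewrite !inE eqxx !orbT.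
  have un' : uniq [:: y1; y2; y3] by case/andP: un.
  rewrite -(card_uniqP un' : #|[:: y1; y2; y3]| = 3); apply/subset_leq_card/subsetP => i.
  move: un; rewrite /= !inE !negb_or => /and4P [/and3P [n1 n2 n3] /andP [n12 n13] n23 _].
  case/or3P => /eqP ->; rewrite !eqxx ?orbT /=; apply/asboolP.
  - have -> : W :\ y1 = [set y3; y2; x]; last exact: Gx3.
    apply/setP => i'; rewrite !inE; case: (eqVneq i' y1) => [->|] /=.
      by rewrite (negPf n12) (negPf n13) eq_sym (negPf n1).
    by case: (i' == x); case: (i' == y1); case: (i' == y2); case: (i' == y3).
  - have -> : W :\ y2 = [set y3; y1; x]; last exact: Gx3.
    apply/setP => i'; rewrite !inE; case: (eqVneq i' y2) => [->|] /=.
      by rewrite (negPf n23) eq_sym (negPf n12) eq_sym (negPf n2).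
    by case: (i' == x); case: (i' == y1); case: (i' == y2); case: (i' == y3).
  - have -> : W :\ y3 = [set y2; y1; x]; last exact: Gx3.
    apply/setP => i'; rewrite !inE; case: (eqVneq i' y3) => [->|] /=.
      by rewrite eq_sym (negPf n23) eq_sym (negPf n13) eq_sym (negPf n3).
    by case: (i' == x); case: (i' == y1); case: (i' == y2); case: (i' == y3).
have [|W [hW Wt nW]] := grow t.+1; first lia.
have hedge a : a \in noncut W -> conn_edge t G (W :\ a).
  rewrite inE => /andP [aW /asboolP ha]; split=> //.
  by have := cardsD1 a W; rewrite aW Wt; lia.
have /card_gt0P [a aN] : 0 < #|noncut W| by apply: leq_trans nW.
have aW : a \in W by move: aN; rewrite inE => /andP [].
have /card_gt0P [b] : 0 < #|noncut W :\ a| by have := cardsD1 a (noncut W); rewrite aN; lia.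
rewrite !inE => /andP [ba bN].
have bN' : b \in noncut W by rewrite inE.
have cola : col a < t.
  by apply: (rainbow (hedge b bN')).2; rewrite !inE eq_sym ba.
have [u] := hcol (hedge a aN) cola; rewrite !inE => /andP [ua uW] cu.
have /card_gt0P [c] : 0 < #|noncut W :\ a :\ u|.
  have h1 := cardsD1 a (noncut W); have h2 := cardsD1 u (noncut W :\ a).
  move: nW; rewrite h1 h2 aN; case: (u \in _); first by rewrite !add1n !ltnS.
  by rewrite add0n add1n ltnS => /ltnW.
rewrite in_setD1 in_setD1 => /and3P [cu' ca cN].
have [inj _] := rainbow (hedge c cN).
have /eqP : a = u.
  by apply: inj => //; rewrite !inE 1?eq_sym ?ca ?cu'.
by rewrite eq_sym (negPf ua).
Qed.

End ConnectedSets.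

(** * Connected graphs of maximum degree two *)

Section PathOrCycle.
Variables (n : nat) (G : rel 'I_n).
Hypotheses (G_sym : symmetric G) (G_irr : irreflexive G) (G_conn : connected_graph G).
Hypothesis n_ge3 : 3 <= n.
Hypothesis deg2 : forall x y1 y2 y3,
  uniq [:: x; y1; y2; y3] -> G x y1 -> G x y2 -> G x y3 -> False.

(* A longest path: its vertex set is closed under adjacency. *)
Lemma hamiltonian_path : exists p : seq 'I_n,
  [/\ uniq p, sorted G p, size p = n & forall x, x \in p].
Proof.
pose P k := [exists p : k.-tuple 'I_n, uniq p && sorted G p].
have x0 : 'I_n := Ordinal (ltnW (ltnW n_ge3)).
have P1 : exists k, P k by exists 1; apply/existsP; exists [tuple x0].
have Pb k : P k -> k <= n.
  case/existsP => p /andP [up _]; rewrite -[k](size_tuple p) -[n in _ <= n]card_ord.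
  by rewrite -(card_uniqP up) max_card.
case: (ex_maxnP P1 Pb) => k /existsP [[p /= /eqP sp] /= /andP [up hp]] kmax.
have maxl q : uniq q -> sorted G q -> size q <= k.
  move=> uq hq; apply: kmax; apply/existsP; exists (in_tuple q); by rewrite /= uq hq.
have e : [set x in p] = [set: 'I_n].
  have [x xp] : exists x, x \in p.
    have : 0 < size p by rewrite sp; apply: (maxl [:: x0]).
    by case: (p) => // x ? _; exists x; rewrite mem_head.
  apply: (@connected_closed n G [set: 'I_n] _ x) => //; rewrite ?inE //.
  move=> a b; rewrite !inE => /(nthP x0) [i ip <-] _ hab.
  apply: contraT => bp.
  (* A vertex off the path adjacent to one of its ends would lengthen it; adjacent to an inner
     vertex it would be a third neighbour. *)
  case: i ip hab => [|i] ip hab.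
    have := maxl (b :: p); rewrite /= bp up sp ltnn => h.
    have [] // : false; apply: h => //.
    by case: (p) hab hp => //= c q hab ->; rewrite G_sym hab.
  case: (ltnP i.+2 k) => hi; last first.
    have := maxl (rcons p b); rewrite rcons_uniq bp up size_rcons sp ltnn => h.
    have [] // : false; apply: h => //.
    case: (p) sp ip hab hp => // c q /= sp' ip hab hq; rewrite rcons_path hq /=.
    by move: hab; rewrite (last_nth x0) -[size q](_ : i.+1 = _) //=; lia.
  have hG j : j.+1 < k -> G (nth x0 p j) (nth x0 p j.+1).
    by move=> hj; apply: (sortedP x0 hp); rewrite sp.
  exfalso; apply: (@deg2 (nth x0 p i.+1) (nth x0 p i) (nth x0 p i.+2) b) => //; last 2 first.
  - rewrite G_sym; apply: hG; exact: ltn_trans hi.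
  - exact: hG.
  have bn j : j < k -> (nth x0 p j == b) = false.
    by move=> hj; apply: contraNF bp => /eqP <-; apply: mem_nth; rewrite sp.
  rewrite /= !inE !nth_uniq ?sp // ?bn //; lia.
exists p; split=> // [|x]; first by rewrite -(card_uniqP up) -cardsE e cardsT card_ord.
by have := in_setT x; rewrite -e inE.
Qed.

(** Vertices are numbered along a Hamiltonian path. A chord at an inner vertex would be its third
    edge, so the only possible chord joins the two ends and decides between path and cycle. *)
Lemma path_or_cycle : graph_iso G (path_graph n) \/ graph_iso G (cycle_graph n).
Proof.
have [p [up hp sp pT]] := hamiltonian_path.
have x0 : 'I_n := Ordinal (ltnW (ltnW n_ge3)).
have ilt x : index x p < n by have := pT x; rewrite -index_mem sp.
pose f x := Ordinal (ilt x).
have bf : bijective f.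
  exists (fun i : 'I_n => nth x0 p i) => [x|i]; first by rewrite /= nth_index.
  by apply/val_inj; rewrite /= index_uniq ?sp.
have hG j : j.+1 < n -> G (nth x0 p j) (nth x0 p j.+1).
  by move=> hj; apply: (sortedP x0 hp); rewrite sp.
have chord i j : i < j < n -> G (nth x0 p i) (nth x0 p j) -> j != i.+1 -> (i == 0) && (j.+1 == n).
  move=> /andP [ij jn] g ji; apply: contraT; rewrite negb_and => /orP [i0|j1]; exfalso.
    apply: (@deg2 (nth x0 p i) (nth x0 p i.-1) (nth x0 p i.+1) (nth x0 p j)) => //.
    - rewrite /= !inE !nth_uniq ?sp //; lia.
    - by rewrite G_sym -{2}(ltn_predK (n := i) (m := 0)) ?lt0n //; apply: hG; lia.
    - by apply: hG; lia.
  apply: (@deg2 (nth x0 p j) (nth x0 p j.-1) (nth x0 p j.+1) (nth x0 p i)) => //.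
  - rewrite /= !inE !nth_uniq ?sp //; lia.
  - rewrite G_sym -{2}(ltn_predK (n := j) (m := i)) //; apply: hG; lia.
  - by apply: hG; lia.
  - by rewrite G_sym.
have adj i j : i < j < n -> G (nth x0 p i) (nth x0 p j) =
    (j == i.+1) || [&& i == 0, j.+1 == n & G (nth x0 p 0) (nth x0 p n.-1)].
  move=> ij; case: eqVneq => [->|ji] /=; first by rewrite hG; lia.
  apply/idP/and3P => [g|[/eqP -> /eqP e]].
    have /andP [/eqP i0 /eqP jn] := chord i j ij g ji.
    have -> : n.-1 = j by lia.
    by split; [rewrite i0|rewrite jn|rewrite -i0].
  by have -> : j = n.-1 by lia.
have adj2 x y : index x p < index y p -> G x y =
   (index y p == (index x p).+1) ||
     [&& index x p == 0, (index y p).+1 == n & G (nth x0 p 0) (nth x0 p n.-1)].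
  move=> xy; rewrite -adj ?xy ?ilt //.
  by rewrite !nth_index.
case c : (G (nth x0 p 0) (nth x0 p n.-1)); [right|left].
  exists f => // x y; rewrite /cycle_graph /path_graph /=.
  case: (ltngtP (index x p) (index y p)) => h.
  - rewrite (adj2 _ _ h) c andbT; move: (index x p) (index y p) h => i j h; lia.
  - rewrite G_sym (adj2 _ _ h) c andbT; move: (index x p) (index y p) h => i j h; lia.
  - have -> : x = y by rewrite -(nth_index x0 (pT x)) h nth_index.
    rewrite G_irr; move: (index y p) => i; lia.
exists f => // x y; rewrite /path_graph /=.
case: (ltngtP (index x p) (index y p)) => h.
- rewrite (adj2 _ _ h) c !andbF; move: (index x p) (index y p) h => i j h; lia.
- rewrite G_sym (adj2 _ _ h) c !andbF; move: (index x p) (index y p) h => i j h; lia.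
- have -> : x = y by rewrite -(nth_index x0 (pT x)) h nth_index.
  rewrite G_irr; move: (index y p) => i; lia.
Qed.

End PathOrCycle.

(** * Mengerian clutters of paths and cycles *)

(** The cyclic windows model the edges of a cycle; the strict bound means weight at least s + 1, one
    unit more than must remain. *)
Definition windows (n t : nat) (a : nat -> nat) (s : nat) : Prop :=
  forall i, i < n -> s < \sum_(j < t) a ((i + j) %% n).

(** [c] is a cover below [a] whose removal leaves weight at least s on every window. *)
Definition peelable (n t : nat) (a : nat -> nat) (s : nat) : Prop :=
  exists c : nat -> nat, forall i, i < n ->
    [/\ c i <= a i, 0 < \sum_(j < t) c ((i + j) %% n) &
        s + \sum_(j < t) c ((i + j) %% n) <= \sum_(j < t) a ((i + j) %% n)].

Lemma windows_rot n t a s r : windows n t a s -> windows n t (fun i => a ((i + r) %% n)) s.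
Proof.
move=> h i i_lt; have n_gt0 : 0 < n by apply: leq_ltn_trans i_lt.
have := h ((i + r) %% n); rewrite ltn_pmod // => /(_ isT).
congr (_ < _); apply: eq_bigr => j _; by rewrite !modnDml addnAC.
Qed.

Lemma peelable_rot n t a s r : peelable n t (fun i => a ((i + r) %% n)) s -> peelable n t a s.
Proof.
move=> [c hc]; exists (fun i => c ((i + (n - r %% n)) %% n)) => i i_lt.
have n_gt0 : 0 < n by apply: leq_ltn_trans i_lt.
pose k := n - r %% n.
have kr m : (m + k + r) %% n = m %% n.
  have kn : k + r %% n = n by rewrite /k subnK // ltnW // ltn_pmod.
  by rewrite -modnDmr -addnA kn modnDr.
have [] := hc ((i + k) %% n); first by rewrite ltn_pmod.
have e (b : nat -> nat) : \sum_(j < t) b (((i + k) %% n + j) %% n) =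
    \sum_(j < t) b (((i + j) %% n + k) %% n).
  by apply: eq_bigr => j _; rewrite !modnDml addnAC.
rewrite (e c) (e (fun i => a ((i + r) %% n))) modnDml kr (modn_small i_lt).
have -> : \sum_(j < t) a ((((i + j) %% n + k) %% n + r) %% n) =
    \sum_(j < t) a ((i + j) %% n).
  by apply: eq_bigr => j _; rewrite modnDml kr modn_mod.
by move=> h1 h2 h3; split.
Qed.

Ltac eval_modn := repeat match goal with |- context[(?x + ?y) %% ?z] =>
  let r := eval vm_compute in ((x + y) %% z) in progress change ((x + y) %% z) with r end.

(** Detects covers already blocked by a known zero of [a], which need no case split. *)
Ltac has_zero a l := lazymatch l with
  | ?i :: ?l' => first [match goal with _ : a i = 0 |- _ => idtac end | has_zero a l']
  end.

(* Once a suitable set of zeros of a is known, any of the listed covers inside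
   the support of a can be peeled off. *)
Ltac peel a n l := tryif has_zero a l then idtac else
  (case: (boolP (all (fun i => 0 < a i) l)) => /= ?;
  [by exists (fun i => count_mem i l);
   do n ![case=> [_|]; [rewrite !big_ord_recr !big_ord0 /=; eval_modn; split=> //=; lia|]] |]).

(** Antipodal pairs meet every window exactly once, so they can be peeled at once. Otherwise each
    pair contains a zero: either three zeros are consecutive, against the window bound, or the
    support is an alternating triple, each point of which has weight above s. *)
Lemma peel6 (a : nat -> nat) s : windows 6 3 a s -> peelable 6 3 a s.
Proof.
move=> h; have := (h 0 isT, h 1 isT, h 2 isT, h 3 isT, h 4 isT, h 5 isT).
rewrite !big_ord_recr !big_ord0 /=; eval_modn => -[[[[[h0 h1] h2] h3] h4] h5] {h}.
peel a 6 [:: 0; 3]. peel a 6 [:: 1; 4]. peel a 6 [:: 2; 5].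
have [?|?] : a 0 = 0 \/ a 3 = 0 by lia.
all: have [?|?] : a 1 = 0 \/ a 4 = 0 by lia.
all: have [?|?] : a 2 = 0 \/ a 5 = 0 by lia.
all: peel a 6 [:: 0; 2; 4]; peel a 6 [:: 1; 3; 5].
all: exfalso; lia.
Qed.

(** After the antipodal pairs, the covers tried are the eight rotations of 0, 3, 6. Each meets a
    window at most twice, and the zeros found before give doubly met windows the weight to spare. *)
Lemma peel8 (a : nat -> nat) s : windows 8 4 a s -> peelable 8 4 a s.
Proof.
move=> h.
have := (h 0 isT, h 1 isT, h 2 isT, h 3 isT, h 4 isT, h 5 isT, h 6 isT, h 7 isT).
rewrite !big_ord_recr !big_ord0 /=; eval_modn => -[[[[[[[h0 h1] h2] h3] h4] h5] h6] h7] {h}.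
peel a 8 [:: 0; 4]. peel a 8 [:: 1; 5]. peel a 8 [:: 2; 6]. peel a 8 [:: 3; 7].
have [?|?] : a 0 = 0 \/ a 4 = 0 by lia.
all: have [?|?] : a 1 = 0 \/ a 5 = 0 by lia.
all: have [?|?] : a 2 = 0 \/ a 6 = 0 by lia.
all: have [?|?] : a 3 = 0 \/ a 7 = 0 by lia.
all: peel a 8 [:: 0; 3; 6]; peel a 8 [:: 1; 4; 7]; peel a 8 [:: 0; 2; 5];
  peel a 8 [:: 1; 3; 6]; peel a 8 [:: 2; 4; 7]; peel a 8 [:: 0; 3; 5];
  peel a 8 [:: 1; 4; 6]; peel a 8 [:: 2; 5; 7].
all: exfalso; lia.
Qed.

Lemma peel9_zeros (a : nat -> nat) s : windows 9 3 a s ->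
  (a 0 = 0 /\ a 1 = 0 /\ a 5 = 0) \/ (a 0 = 0 /\ a 2 = 0 /\ a 4 = 0) -> peelable 9 3 a s.
Proof.
move=> h.
have := (h 0 isT, h 1 isT, h 2 isT, h 3 isT, h 4 isT, h 5 isT, h 6 isT, h 7 isT, h 8 isT).
rewrite !big_ord_recr !big_ord0 /=; eval_modn => -[[[[[[[[h0 h1] h2] h3] h4] h5] h6] h7] h8] {h}.
case=> -[? [? ?]].
all: peel a 9 [:: 2; 3; 6; 8]; peel a 9 [:: 1; 3; 6; 7]; peel a 9 [:: 2; 4; 7; 8].
(* The window 4, 5, 6 meets [2; 4; 6; 8] twice. It has weight at least s + 2 because the failure of
   [2; 3; 6; 8] forces [a 3 = 0], so that [a 4] alone exceeds s. *)
all: peel a 9 [:: 1; 3; 5; 7]; peel a 9 [:: 2; 4; 6; 8]; peel a 9 [:: 1; 3; 6; 8];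
  peel a 9 [:: 1; 3; 5; 8].
all: exfalso; lia.
Qed.

Ltac try_rot r rot := first [by apply: (rot r 1 5) | by apply: (rot r 2 4)].

(* Up to rotation, three zeros in distinct classes modulo 3, not consecutive, are
   at 0, 1, 5 or at 0, 2, 4. *)
Lemma peel9 (a : nat -> nat) s : windows 9 3 a s -> peelable 9 3 a s.
Proof.
move=> h; have hr r := windows_rot r h.
have rot r z1 z2 : (z1, z2) \in [:: (1, 5); (2, 4)] -> a (r %% 9) = 0 ->
    a ((z1 + r) %% 9) = 0 -> a ((z2 + r) %% 9) = 0 -> peelable 9 3 a s.
  rewrite !inE => /orP [] /eqP [-> ->] *; apply: peelable_rot (peel9_zeros (hr r) _).
    by left.
  by right.
have := (h 0 isT, h 1 isT, h 2 isT, h 3 isT, h 4 isT, h 5 isT, h 6 isT, h 7 isT, h 8 isT).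
rewrite !big_ord_recr !big_ord0 /=; eval_modn => -[[[[[[[[h0 h1] h2] h3] h4] h5] h6] h7] h8].
peel a 9 [:: 0; 3; 6]. peel a 9 [:: 1; 4; 7]. peel a 9 [:: 2; 5; 8].
have [?|[?|?]] : a 0 = 0 \/ a 3 = 0 \/ a 6 = 0 by lia.
all: have [?|[?|?]] : a 1 = 0 \/ a 4 = 0 \/ a 7 = 0 by lia.
all: have [?|[?|?]] : a 2 = 0 \/ a 5 = 0 \/ a 8 = 0 by lia.
all: first [exfalso; lia | try_rot 0 rot | try_rot 1 rot | try_rot 2 rot | try_rot 3 rot
  | try_rot 4 rot | try_rot 5 rot | try_rot 6 rot | try_rot 7 rot | try_rot 8 rot].
Qed.

(* List a_x copies of each vertex x in the order of positions and give the l-th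
   copy the colour l mod s: s consecutive copies see every colour. *)
Lemma interval_mengerian n (H : {set 'I_n} -> Prop) (pos : 'I_n -> nat) :
  injective pos ->
  (forall S, H S -> exists l u, S = [set x | l <= pos x < u]) -> mengerian H.
Proof.
move=> pinj hH s a ha.
pose A i := \sum_(x | pos x < i) a x.
have AS x : A (pos x).+1 = A (pos x) + a x.
  rewrite /A (bigD1 x) ?ltnS //= addnC; congr (_ + _); apply: eq_bigl => y.
  rewrite ltnS ltn_neqAle andbC; congr (_ && _); congr (~~ _).
  by apply/eqP/eqP => [->//|/pinj].
have A_add i j : i <= j -> A j = A i + \sum_(x in [set x | i <= pos x < j]) a x.
  move=> ij; rewrite /A (bigID (fun x => pos x < i)) /=; congr (_ + _); apply: eq_bigl => x.
    by rewrite andb_idl // => h; apply: leq_trans ij.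
  by rewrite inE -leqNgt andbC.
have A_mono i j : i <= j -> A i <= A j by move=> /A_add ->; apply: leq_addr.
exists (fun (k : 'I_s) x => \sum_(A (pos x) <= l < A (pos x).+1) (l %% s == k)); split=> [x|k S HS].
  rewrite exchange_big /=.
  apply: (@leq_trans (\sum_(A (pos x) <= l < A (pos x).+1) 1)).
    apply: leq_sum => l _; case: (posnP s) => [s0|s0].
      by rewrite big1 // => -[k hk]; exfalso; rewrite s0 in hk.
    rewrite (bigD1 (Ordinal (ltn_pmod l s0))) //= eqxx big1 // => k hk.
    by apply/eqP; rewrite eqb0; apply: contra hk => /eqP e; apply/eqP/val_inj.
  by rewrite sum_nat_const_nat muln1 AS addKn.
have [lo [u e]] := hH S HS.
have s_gt0 : 0 < s by apply: leq_ltn_trans (ltn_ord k).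
have sS := ha S HS.
have lou : lo <= u.
  rewrite leqNgt; apply/negP => ul.
  have e0 : S = set0 by rewrite e; apply/setP => x; rewrite !inE; apply/negP; move: ul; lia.
  by move: sS; rewrite e0 big_set0 leqNgt s_gt0.
(* The first copy numbered at least [A lo] with residue k modulo s; it lies among the first s copies
   of the interval. *)
pose l := A lo + (k + (s - A lo %% s)) %% s.
have lk : l %% s = k.
  rewrite /l modnDmr addnCA -modnDmr.
  rewrite (_ : (A lo + (s - A lo %% s)) %% s = 0).
    by rewrite addn0 modn_small.
  by rewrite -modnDml subnKC ?modnn // ltnW // ltn_pmod.
have lu : l < A u.
  rewrite (A_add lo u) // -e; apply: leq_trans (leq_add (leqnn _) sS).
  by rewrite ltn_add2l ltn_pmod.
(* The least such index is one more than the position of the vertex owning copy l. *)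
have ex : exists i, l < A i by exists u.
case: (ex_minnP ex) => -[|i] li imin.
  by have := A_mono 0 lo isT; move: li; rewrite /l; lia.
have il : A i <= l by rewrite leqNgt; apply/negP => /imin; rewrite ltnn.
have [x xi] : exists x, pos x = i.
  apply: contrapT => no; move: (leq_ltn_trans il li); rewrite /A.
  rewrite [X in _ < X](eq_bigl (fun x => pos x < i)) ?ltnn // => x.
  rewrite ltnS leq_eqVlt; case: eqP => // h; by case: no; exists x.
exists x.
  rewrite e inE xi (imin u lu) andbT leqNgt; apply/negP => h.
  by have := A_mono i.+1 lo h; move: li; rewrite /l; lia.
rewrite xi (@big_cat_nat _ _ _ l.+1) //=; last exact: leqW.
by rewrite big_nat_recr //= lk eqxx addn1.
Qed.

(** * Arcs of a cycle *)

Section Cycle.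
Variables (n t : nat) (G : rel 'I_n).
Hypotheses (G_sym : symmetric G) (n_ge3 : 3 <= n).
Hypothesis cyc : graph_iso G (cycle_graph n).
Implicit Types (S : {set 'I_n}).

(** Indexing the cycle periodically by all naturals removes the wrap-around cases of
    [cycle_graph]. *)
Lemma cycle_enum : exists e : nat -> 'I_n,
  [/\ forall i j, (e i == e j) = (i == j %[mod n]), forall x, exists i, e i = x,
      forall i, G (e i) (e i.+1) &
      forall i j, G (e i) (e j) -> e j = e i.+1 \/ e i = e j.+1].
Proof.
have [f [g fK gK] fG] := cyc; have n0 : 0 < n by lia.
pose e i := g (Ordinal (ltn_pmod i n0)).
have eE i j : (e i == e j) = (i == j %[mod n]).
  by rewrite (inj_eq (can_inj gK)) -val_eqE.
have GE i j : G (e i) (e j) = cycle_graph n (Ordinal (ltn_pmod i n0)) (Ordinal (ltn_pmod j n0)).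
  by rewrite -fG !gK.
have S_mod i : (i.+1 %% n = (i %% n).+1 /\ (i %% n).+1 < n) \/ (i.+1 %% n = 0 /\ (i %% n).+1 = n).
  rewrite -addn1 -modnDml addn1; have := ltn_pmod i n0; rewrite leq_eqVlt => /orP [/eqP h|h].
    by right; rewrite h modnn.
  by left; rewrite modn_small.
exists e; split=> //.
- by move=> x; exists (f x); apply: (can_inj fK); rewrite /e gK; apply/val_inj;
    rewrite /= modn_small.
- move=> i; rewrite GE /cycle_graph /path_graph /=; have := S_mod i; lia.
- move=> i j; rewrite GE /cycle_graph /path_graph /= => h.
  suff [] : (j == i.+1 %[mod n]) \/ (i == j.+1 %[mod n]).
    by rewrite -eE => /eqP; left.
    by rewrite -eE => /eqP; right.
  have := S_mod i; have := S_mod j; have := ltn_pmod i n0; have := ltn_pmod j n0; move: h.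
  move: (i %% n) (j %% n) (i.+1 %% n) (j.+1 %% n) => i1 j1 i2 j2; lia.
Qed.

Variable e : nat -> 'I_n.
Hypotheses (eE : forall i j, (e i == e j) = (i == j %[mod n]))
  (e_surj : forall x, exists i, e i = x) (e_adj : forall i, G (e i) (e i.+1))
  (adj_e : forall i j, G (e i) (e j) -> e j = e i.+1 \/ e i = e j.+1).

Definition cyc_arc s k : {set 'I_n} := [set e (s + j) | j : 'I_k].

Lemma arcP s k x : reflect (exists2 j, j < k & x = e (s + j)) (x \in cyc_arc s k).
Proof.
apply: (iffP imsetP) => [[j _ ->]|[j jk ->]]; first by exists j.
by exists (Ordinal jk).
Qed.

Lemma e_inj s j j' : j < n -> j' < n -> e (s + j) = e (s + j') -> j = j'.
Proof. by move=> jn jn' /eqP; rewrite eE eqn_modDl !modn_small // => /eqP. Qed.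

Lemma arc_inj s k : k <= n -> injective (fun j : 'I_k => e (s + j)).
Proof.
move=> kn j j' /e_inj h; apply/val_inj/h; exact: leq_trans kn.
Qed.

Lemma card_arc s k : k <= n -> #|cyc_arc s k| = k.
Proof. by move=> kn; rewrite card_imset ?card_ord //; apply: arc_inj. Qed.

Lemma e_addn i : e (i + n) = e i.
Proof. by apply/eqP; rewrite eE modnDr. Qed.

Lemma arc_connected s k : 0 < k -> induced_connected G (cyc_arc s k).
Proof.
case: k => // k _; elim: k => [|k IHk].
  have -> : cyc_arc s 1 = [set e s].
    apply/setP => x; rewrite inE; apply/arcP/eqP => [[[|]// _ ->]|->]; first by rewrite addn0.
    by exists 0; rewrite ?addn0.
  exact: connected1.
have -> : cyc_arc s k.+2 = e (s + k.+1) |: cyc_arc s k.+1.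
  apply/setP => x; rewrite in_setU1; apply/arcP/orP.
    move=> [j jk ->]; move: jk; rewrite ltnS leq_eqVlt => /orP [/eqP ->|jk]; first by left.
    by right; apply/arcP; exists j.
  move=> [/eqP ->|/arcP [j jk ->]]; first by exists k.+1.
  by exists j => //; apply: ltnW.
apply: (connected_add G_sym IHk _ (_ : G (e (s + k)) _)); first by apply/arcP; exists k.
by rewrite addnS.
Qed.

Lemma arc_edge s : 0 < t <= n -> conn_edge t G (cyc_arc s t).
Proof. by move=> /andP[t0 tn]; split; [apply: card_arc|apply: arc_connected]. Qed.

(** From a vertex outside [S] one walks to the first vertex of [S] and takes the maximal run there;
    the run is closed under adjacency in [S], hence is all of [S]. *)
Lemma edge_arc S : t < n -> conn_edge t G S -> exists s, S = cyc_arc s t.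
Proof.
move=> tn [cS hS].
have [x xS] : exists x, x \notin S.
  apply: contrapT => no; have : S = setT.
    by apply/setP => x; rewrite inE; apply: contrapT => /negP h; apply: no; exists x.
  by move=> h; move: cS tn; rewrite h cardsT card_ord => ->; rewrite ltnn.
have [/set0Pn [y yS] _] := hS.
have [i ex] := e_surj x; have [j ey] := e_surj y.
have exd : exists d, e (i + d) \in S.
  exists (j + i * n - i); rewrite subnKC; last by have := leq_pmulr i (ltnW (ltnW n_ge3)); lia.
  suff -> : e (j + i * n) = e j by rewrite ey.
  by apply/eqP; rewrite eE addnC modnMDl.
case: (ex_minnP exd) => -[|d] dS dmin; first by rewrite addn0 ex (negPf xS) in dS.
pose s := i + d.+1.
have sS' : e (i + d) \notin S by apply/negP => /dmin; rewrite ltnn.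
(* After n - 1 steps the walk is back at the vertex preceding the run, which is outside [S]. *)
have exk : exists k, e (s + k) \notin S.
  by exists n.-1; rewrite /s addnS addSnnS prednK ?e_addn //; lia.
case: (ex_minnP exk) => k kS kmin.
have lek : k <= n.
  apply: leq_trans (kmin n.-1 _) (leq_pred _).
  by rewrite /s addnS addSnnS prednK ?e_addn //; lia.
have inS j' : j' < k -> e (s + j') \in S.
  by move=> jk; apply: contraLR jk => /kmin; rewrite -leqNgt.
have k0 : 0 < k by case: (k) kS => //; rewrite addn0 dS.
have aS : cyc_arc s k = S.
  apply: (@connected_closed n G S (cyc_arc s k) (e s) hS).
  - by apply/subsetP => z /arcP [j' jk ->]; apply: inS.
  - by apply/arcP; exists 0; rewrite ?addn0.
  move=> a b /arcP [j' jk ->] bS; have [l eb] := e_surj b; rewrite -eb => /adj_e [el|h].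
    rewrite el; apply/arcP; exists j'.+1; last by rewrite addnS.
    rewrite ltn_neqAle jk andbT; apply: contraNneq kS => <-.
    by rewrite addnS -el eb.
  have eP p q : e p.+1 = e q.+1 -> e p = e q.
    by move=> /eqP; rewrite eE -(addn1 p) -(addn1 q) eqn_modDr -eE => /eqP.
  case: j' jk h => [|j'] jk h.
    have hl : e (i + d) = e l by apply: eP; rewrite -h addn0 /s addnS.
    by move: sS'; rewrite hl eb bS.
  by apply/arcP; exists j'; [apply: ltnW|apply: eP; rewrite -h addnS].
exists s; rewrite -aS; congr (cyc_arc s _).
by rewrite -cS -aS card_arc.
Qed.

(** Induction on s: one cover is peeled off, and the remaining weight still satisfies the bound s on
    every edge. *)
Lemma cycle_mengerian : 0 < t < n ->
  (forall a s, windows n t a s -> peelable n t a s) ->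
  mengerian (conn_edge t G).
Proof.
move=> /andP [t0 tn] peel s; elim: s => [|s IHs] a ha.
  by exists (fun _ _ => 0); split=> [i|[]//]; rewrite big_ord0.
have n0 : 0 < n by lia.
have e_mod i : e (i %% n) = e i by apply/eqP; rewrite eE modn_mod.
have arc_sum (b : 'I_n -> nat) i : \sum_(x in cyc_arc i t) b x = \sum_(j < t) b (e (i + j)).
  by rewrite big_imset //= => u v _ _; apply: arc_inj; apply: ltnW.
have [|c hc] := peel (fun i => a (e i)) s.
  move=> i _; have := ha _ (@arc_edge i _); rewrite t0 ltnW // => /(_ isT).
  by rewrite arc_sum; under [X in _ -> _ < X]eq_bigr do rewrite e_mod.
have /choice [f hf] : forall x, exists i, i < n /\ e i = x.
  by move=> x; have [i <-] := e_surj x; exists (i %% n); rewrite ltn_pmod.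
have fe i : f (e i) = i %% n.
  have [h1 /eqP] := hf (e i); rewrite eE => /eqP; by rewrite modn_small.
have [|b [hb hcov]] := IHs (fun x => a x - c (f x)).
  move=> S /(edge_arc tn) [i ->]; rewrite -(leq_add2r (\sum_(j < t) c ((i + j) %% n))).
  have [|_ _ hci] := hc (i %% n); first by rewrite ltn_pmod.
  have e1 (b : nat -> nat) :
      \sum_(j < t) b ((i %% n + j) %% n) = \sum_(j < t) b ((i + j) %% n).
    by apply: eq_bigr => j _; rewrite modnDml.
  rewrite (e1 c) (e1 (fun i => a (e i))) in hci; apply: leq_trans hci _.
  under [X in X <= _]eq_bigr do rewrite e_mod; rewrite arc_sum -big_split /=; apply: leq_sum => j _.
  rewrite fe; lia.
exists (fun k x => if unlift ord0 k is Some k' then b k' x else c (f x)); split.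
  move=> x; rewrite big_ord_recl unlift_none; under eq_bigr do rewrite liftK.
  have [fx <-] := hf x; have [+ _ _] := hc (f x) fx; have := hb x.
  by have [_ ex] := hf x; rewrite ex; lia.
move=> k S HS; case: unliftP => [k' _|_]; first exact: hcov.
have [i ->] := edge_arc tn HS.
have [|_ + _] := hc (i %% n); first by rewrite ltn_pmod.
rewrite lt0n sum_nat_eq0 negb_forall => /existsP [j]; rewrite /= -lt0n modnDml => hj.
by exists (e (i + j)); [apply/arcP; exists j|rewrite fe].
Qed.

End Cycle.

(** * Obstructions for cycles *)

Lemma packed_colorable n (H : {set 'I_n} -> Prop) t : packed H ->
  (exists S, H S) -> (forall S, H S -> #|S| = t) -> colorable H t.
Proof.
move=> pH [S0 HS0] Ht.
have mE S : minor (fun=> None) H S <-> H S.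
  split=> [[S1 [HS1 _ ->]]|HS].
    by rewrite (_ : [set i in S1 | _] = S1) //; apply/setP => i; rewrite inE eqxx andbT.
  by exists S; split=> //; apply/setP => i; rewrite inE eqxx andbT.
have [||col hcol] := pH (fun=> None) S0; first exact/mE.
  by move=> S' /mE /Ht ->; rewrite Ht.
by exists col => S /mE HS k; rewrite -(Ht S0 HS0); apply: hcol.
Qed.

Section BalancedPoints.
Variables (q t : nat).
Hypothesis qt : t.+1 <= (t - 2) * q.

(* 2q + 1 points spread as evenly as possible over a cycle of length qt. *)
Definition bal i := i * (q * t) %/ (2 * q).+1.

(** After expansion this is the hypothesis [qt]: three mean gaps qt / (2q + 1) amount to at least t
    + 1. *)
Let tq : (t.+1) * (2 * q).+1 <= 3 * (q * t).
Proof. by case: t qt => [|[|t']] //; rewrite subSS subSS subn0; nia. Qed.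

Lemma bal0 : bal 0 = 0. Proof. by rewrite /bal mul0n div0n. Qed.

Lemma bal_period i c : bal (i + c * (2 * q).+1) = bal i + c * (q * t).
Proof. by rewrite /bal mulnDl mulnAC divnDMl. Qed.

(** Two mean gaps are less than t, and rounding down costs less than one. *)
Lemma bal_le2 i : bal i.+2 <= bal i + t.
Proof.
rewrite -ltnS -addSn /bal ltn_divLR //.
have := ltn_ceil (i * (q * t)) (ltn0Sn (2 * q)).
move: (i * (q * t) %/ (2 * q).+1) => b; rewrite !mulSn !addSn mulnDl.
nia.
Qed.

Lemma bal_ge3 i : bal i + t.+1 <= bal i.+3.
Proof.
rewrite /bal leq_divRL //.
have := leq_divM (i * (q * t)) (2 * q).+1.
move: (i * (q * t) %/ (2 * q).+1) => b; rewrite mulnDl !mulSn; move: tq; rewrite !mulSn mul0n.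
lia.
Qed.

Lemma bal_lt i : bal i < bal i.+1.
Proof.
rewrite /bal leq_divRL //.
have := leq_divM (i * (q * t)) (2 * q).+1.
have h : (2 * q).+1 <= q * t by case: t qt => [|[|[|t']]] //; rewrite ?subSS ?subn0; nia.
move: (i * (q * t) %/ (2 * q).+1) => b; rewrite [b.+1 * _]mulSn [i.+1 * _]mulSn.
lia.
Qed.

Lemma bal_mono : {mono bal : i j / i < j}.
Proof. exact/leqW_mono/leq_mono/(homo_ltn ltn_trans bal_lt). Qed.

End BalancedPoints.

Section PackedCycle.
Variables (n t : nat) (G : rel 'I_n).
Hypotheses (G_sym : symmetric G) (t_ge3 : 3 <= t) (t_lt_n : t < n).
Variable e : nat -> 'I_n.
Hypotheses (eE : forall i j, (e i == e j) = (i == j %[mod n]))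
  (e_surj : forall x, exists i, e i = x) (e_adj : forall i, G (e i) (e i.+1))
  (adj_e : forall i j, G (e i) (e j) -> e j = e i.+1 \/ e i = e j.+1).

Let n_ge3 : 3 <= n. Proof. by lia. Qed.

Let edge s : conn_edge t G (cyc_arc e s t).
Proof. by apply: (arc_edge G_sym eE e_adj); lia. Qed.

(** Consecutive arcs differ only in their end vertices, so the colouring has period t along the
    cycle. If t did not divide n, the first multiple of t beyond n would give vertices 0 and
    [t - n %% t] of one rainbow arc the same colour. *)
Lemma colorable_dvd : colorable (conn_edge t G) t -> t %| n.
Proof.
move=> [col hcol].
have rain s := rainbow hcol (edge s).
have inj s j j' : j < t -> j' < t -> col (e (s + j)) = col (e (s + j')) -> j = j'.
  move=> jt jt' h; have [h1 _] := rain s.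
  apply: (@e_inj n e eE s); [lia|lia|].
  by apply: h1 => //; apply/arcP; [exists j|exists j'].
have per i : col (e (i + t)) = col (e i).
  have ct : col (e (i + t)) < t.
    apply: (rain i.+1).2; apply/arcP; exists t.-1; first lia.
    by rewrite addSnnS prednK //; lia.
  have [_ /arcP [[|j] jt ->] cj] := hcol _ (edge i) _ ct; first by rewrite -cj addn0.
  exfalso; have : j = t.-1; last lia.
  apply: (inj i.+1); [lia|lia|].
  by rewrite !addSnnS cj prednK //; lia.
have perq i k : col (e (i + k * t)) = col (e i).
  by elim: k => [|k IHk]; rewrite ?addn0 // mulSn addnCA addnC per.
rewrite /dvdn; apply/negPn/negP; rewrite -lt0n => r0.
have t0 : 0 < t by lia.
have rt := ltn_pmod n t0.
have : t - n %% t = 0; last lia.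
apply: (inj 0); [lia|lia|].
rewrite add0n -(perq (0 + 0) (n %/ t).+1) !add0n; congr col; apply/eqP; rewrite eE.
have -> : (n %/ t).+1 * t = n + (t - n %% t).
  have := divn_eq n t; rewrite mulSn; move: rt.
  by move: (n %/ t * t) (n %% t) => u w; lia.
by rewrite modnDl.
Qed.

(* Contracting everything but the 2q + 1 balanced points leaves edges of size at
   least 2, among them all pairs of consecutive points: an odd cycle. *)
Lemma packed_cycle_small q : n = q * t -> packed (conn_edge t G) -> (t - 2) * q <= t.
Proof.
move=> nq pH; rewrite leqNgt; apply/negP => qt.
pose p := bal q t; pose D := (2 * q).+1.
have plt := bal_lt qt; have pmono := bal_mono qt; rewrite -/p in plt pmono.
have p0 : p 0 = 0 := bal0 q t.
have p2 i : p i.+2 <= p i + t := bal_le2 qt i.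
have p3 i : p i + t.+1 <= p i.+3 := bal_ge3 qt i.
have pper i c : p (i + c * D) = p i + c * n by rewrite nq; apply: bal_period.
have n0 : 0 < n by lia.
pose M := [set e (p i) | i : 'I_D].
have inM j : reflect (exists i, p i = j) (e j \in M).
  apply: (iffP imsetP) => [[i _ /eqP]|[i <-]].
    rewrite eE => /eqP h; have pn : p i < n.
      have := pper 0 1; rewrite add0n !mul1n p0 add0n => <-.
      by rewrite pmono.
    rewrite (modn_small pn) in h; exists (i + j %/ n * D).
    by rewrite pper -h addnC -divn_eq.
  exists (Ordinal (ltn_pmod i (ltn0Sn (2 * q)))) => //=.
  apply/eqP; rewrite eE -/D {1}(divn_eq i D) addnC pper.
  by rewrite addnC modnMDl.
have pe s j j' : j < t -> j' < t -> e (s + j) = e (s + j') -> j = j'.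
  by move=> jt jt'; apply: (@e_inj n e eE); lia.
(* Nothing is deleted, so the edges of this minor are exactly the traces of arcs on [M]. *)
pose v i := if i \in M then None else Some false.
have minorE S : minor v (conn_edge t G) S <-> exists s, S = cyc_arc e s t :&: M.
  have sM (S1 : {set 'I_n}) : [set i in S1 | v i == None] = S1 :&: M.
    by apply/setP => i; rewrite !inE /v; case: (i \in M).
  split=> [[S1 [/(edge_arc n_ge3 eE e_surj adj_e t_lt_n) [s ->] _ ->]]|[s ->]].
    by exists s; rewrite sM.
  exists (cyc_arc e s t); split=> //; first by move=> i _; rewrite /v; case: ifP.
(* The arc of length t ending just before [p i.+3] misses [p i] by [p3] and contains [p i.+1] by
   [p2]. *)
have pair i : cyc_arc e (p i.+3 - t) t :&: M = [set e (p i.+1); e (p i.+2)].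
  have h3 := p3 i; have h2 := p2 i.+1.
  apply/setP => x; rewrite in_setI in_set2; apply/andP/orP.
    move=> [/arcP [j jt ->] /inM [k hk]].
    have : i < k < i.+3 by rewrite -(pmono i) -(pmono k) hk; lia.
    move=> ik; rewrite -hk; have [->|->] : k = i.+1 \/ k = i.+2 by lia.
      by left.
    by right.
  have l1 := plt i.+1; have l2 := plt i.+2.
  by case=> /eqP ->; split; try (by apply/inM; eexists); apply/arcP;
     [exists (p i.+1 - (p i.+3 - t))|exists (p i.+2 - (p i.+3 - t))]; rewrite ?subnKC //; lia.
have ne i : e (p i.+1) != e (p i.+2).
  have l1 := plt i.+1; have l2 := plt i.+2; have l3 := p2 i.+1.
  apply/eqP => h.
  have : 0 = p i.+2 - p i.+1; last lia.
  by apply: (pe (p i.+1)); rewrite ?addn0 ?subnKC //; lia.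
have card2 i : #|cyc_arc e (p i.+3 - t) t :&: M| = 2 by rewrite pair cards2 ne.
have [|S|col hcol] := pH v (cyc_arc e (p 3 - t) t :&: M); first by apply/minorE; eexists.
  move=> /minorE [s0 ->]; rewrite card2.
  (* The extra turn makes s positive, so the first point from s on is not [p 0] and has a
     predecessor before s. *)
  pose s := s0 + n.
  have -> : cyc_arc e s0 t = cyc_arc e s t.
    apply/setP => x; apply/arcP/arcP => [] [j jt ->]; exists j => //;
      by apply/eqP; rewrite eE /s addnAC modnDr.
  have [k pk] : exists k, s <= p k.
    exists s; elim: (s) => // k IHk; exact: leq_ltn_trans IHk (plt k).
  have exk : exists k, s <= p k by exists k.
  case: (ex_minnP exk) => {k pk} -[|k] sk kmin.
    by move: sk; rewrite p0 /s; lia.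
  have ks : p k < s by rewrite ltnNge; apply/negP => /kmin; rewrite ltnn.
  have l1 := plt k.+1; have l2 := p2 k.
  apply: (@leq_trans #|[set e (p k.+1); e (p k.+2)]|); first by rewrite cards2 ne.
  apply/subset_leq_card/subsetP => x; rewrite in_setI => /set2P [] ->; apply/andP.
    split; last by apply/inM; eexists.
    by apply/arcP; exists (p k.+1 - s); rewrite ?subnKC //; lia.
  split; last by apply/inM; eexists.
  by apply/arcP; exists (p k.+2 - s); rewrite ?subnKC //; lia.
rewrite card2 in hcol.
have alt i : col (e (p i.+1)) + col (e (p i.+2)) = 1.
  have hm : minor v (conn_edge t G) [set e (p i.+1); e (p i.+2)].
    by apply/minorE; exists (p i.+3 - t); rewrite pair.
  have [x + hx] := hcol _ hm 0 isT; have [y + hy] := hcol _ hm 1 isT.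
  by move=> /set2P [] hy' /set2P [] hx'; move: hx hy; rewrite hx' hy'; lia.
have even k : col (e (p (1 + 2 * k))) = col (e (p 1)).
  elim: k => // k IHk; have := alt (2 * k); have := alt (2 * k).+1; move: IHk.
  rewrite (_ : 1 + 2 * k.+1 = (2 * k).+3); last lia.
  rewrite add1n; lia.
(* Point 2q + 1 has the colour of point 1, and its successor is point 1 one turn later, so [alt]
   would make twice a colour equal to 1. *)
have := alt (2 * q); have := even q; rewrite add1n => ->.
rewrite (_ : (2 * q).+2 = 1 + 1 * D); last by rewrite /D; lia.
rewrite pper (_ : e (p 1 + 1 * n) = e (p 1)); first lia.
by apply/eqP; rewrite eE mul1n modnDr.
Qed.

End PackedCycle.

(** The run of consecutive positions starting at the least position of [S] is closed under adjacency
    in [S], so it exhausts [S]. *)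
Lemma path_edge_interval n t (G : rel 'I_n) (f : 'I_n -> 'I_n) S :
  injective f -> {mono f : x y / G x y >-> path_graph n x y} -> conn_edge t G S ->
  exists l u, S = [set x | l <= f x < u].
Proof.
move=> finj fG [_ hS]; have [/set0Pn [x0 x0S] _] := hS.
case: (arg_minnP (fun x => f x : nat) x0S) => x1 x1S xmin.
have exk : exists k, ~~ [exists x in S, f x == f x1 + k :> nat].
  exists n; apply/negP => /exists_inP [x _ /eqP h]; have := ltn_ord (f x); lia.
case: (ex_minnP exk) => k /exists_inPn kS kmin.
have inS j : j < k -> exists2 x, x \in S & f x = f x1 + j :> nat.
  move=> jk; apply: contrapT => h; have : k <= j; last by rewrite leqNgt jk.
  by apply/kmin/negP => /exists_inP [x xS /eqP e]; apply: h; exists x.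
exists (f x1), (f x1 + k).
have e : [set x in S | f x < f x1 + k] = S.
  apply: (@connected_closed n G S _ x1 hS).
  - by apply/fintype.subsetP => x; rewrite inE => /andP [].
  - rewrite inE -[nat_of_ord (f x1) in X in X < _]addn0 ltn_add2l lt0n; apply/andP; split=> //.
    by apply: contraNneq (kS _ x1S) => ->; rewrite addn0.
  move=> a b; rewrite !inE => /andP [aS ak] bS; rewrite -fG bS /= => /orP h.
  have := kS _ bS; move: h ak; case=> /eqP; lia.
apply/finset.setP => x; rewrite inE; apply/idP/andP => [xS|[h1 h2]].
  split; first exact: xmin.
  by move: xS; rewrite -{1}e inE => /andP [].
have [|y yS hy] := inS (f x - f x1); first lia.
suff -> : x = y by [].
by apply/finj/val_inj; rewrite /= hy; lia.
Qed.

(** * Combinatorial classification *)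

Definition good_graph n t (G : rel 'I_n) :=
  [\/ n = t,
      (t <= n) /\ graph_iso G (path_graph n)
    | graph_iso G (cycle_graph n) /\
      [\/ t = 3 /\ n \in [:: 3; 6; 9],
          t = 4 /\ n \in [:: 4; 8]
        | (5 <= t) /\ n = t]].

Lemma good_mengerian n t (G : rel 'I_n) : symmetric G -> 3 <= t <= n ->
  good_graph t G -> mengerian (conn_edge t G).
Proof.
move=> G_sym /andP [t3 tn] hG.
(* When n = t the only possible edge is the whole vertex set, an interval in any numbering. *)
have [e|nt] := eqVneq n t.
  apply: (@interval_mengerian n _ (fun i => i)); first exact: val_inj.
  move=> S [cS _]; exists 0, n.
  have -> : S = [set: 'I_n].
    by apply/eqP; rewrite eqEcard finset.subsetT cardsT card_ord cS; lia.
  by apply/finset.setP => x; rewrite !inE ltn_ord.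
case: hG => [e|[_ [f fbij fG]]|[cyc hG]]; first by rewrite e eqxx in nt.
  apply: (@interval_mengerian n _ (fun i => f i)).
    by move=> x y /val_inj; apply: bij_inj.
  by move=> S hS; apply: path_edge_interval hS => //; apply: bij_inj.
have n3 : 3 <= n by apply: leq_trans tn.
have [e [eE e_surj e_adj adj_e]] := cycle_enum n3 cyc.
have tn' : 0 < t < n by lia.
apply: (cycle_mengerian G_sym n3 eE e_surj e_adj adj_e tn').
case: hG => [[t_eq]|[t_eq]|[_ e']]; last by rewrite e' eqxx in nt.
  rewrite !inE t_eq => /or3P [] /eqP n_eq a s;
    [|rewrite n_eq; exact: peel6|rewrite n_eq; exact: peel9].
  by rewrite n_eq t_eq in nt.
rewrite !inE t_eq => /orP [] /eqP n_eq a s; [|rewrite n_eq; exact: peel8].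
by rewrite n_eq t_eq in nt.
Qed.

Lemma packed_good n t (G : rel 'I_n) : symmetric G -> irreflexive G ->
  connected_graph G -> 3 <= t <= n -> packed (conn_edge t G) -> good_graph t G.
Proof.
move=> G_sym G_irr G_conn /andP [t3 tn] pH.
have [e|nt] := eqVneq n t; first exact: Or31.
have {nt} tn' : t < n by lia.
have col : colorable (conn_edge t G) t.
  apply: packed_colorable => //; last by move=> S [].
  have [||W [_ hW cW]] := @connected_extend n G G_sym G_conn [set Ordinal (ltn_trans t3 tn')] t.
  - exact: connected1.
  - by rewrite cards1; lia.
  by exists W.
have [c hc] := col.
have n3 : 3 <= n by lia.
case: (path_or_cycle G_sym G_irr G_conn n3 (degree_le2 G_sym G_conn t3 tn' hc)) => [h|cyc].
  exact: Or32.
apply: Or33; split=> //.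
have [e [eE e_surj e_adj adj_e]] := cycle_enum n3 cyc.
have /dvdnP [q nq] := colorable_dvd G_sym t3 tn' eE e_adj col.
have qs := packed_cycle_small G_sym t3 tn' eE e_surj e_adj adj_e nq pH.
have q2 : 1 < q by move: tn'; rewrite nq; case: (q) => [|[|]] //; rewrite ?mul0n ?mul1n ?ltn0 ?ltnn.
(* Since q is at least 2, (t - 2)q <= t gives t <= 4; then q <= 3 for t = 3 and q = 2 for t = 4. *)
have [t4|t5] := leqP t 4; last by exfalso; nia.
have [t_eq|t_eq] : t = 3 \/ t = 4 by lia.
  apply: Or31; split=> //; rewrite nq t_eq !inE.
  by have : q = 2 \/ q = 3 by [move: qs; rewrite t_eq; lia]; case=> ->.
apply: Or32; split=> //; rewrite nq t_eq !inE.
by have -> : q = 2 by move: qs; rewrite t_eq; lia.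
Qed.

(** * Ideals and heights *)

From mathcomp Require Import classical_sets.
Import GRing.Theory.

Section Ideals.
Local Open Scope classical_set_scope.
Local Open Scope ring_scope.
Variable R : comNzRingType.
Implicit Types (I P : set R) (f g : R).

Definition is_ideal I := [/\ I 0, forall f g, I f -> I g -> I (f + g) &
  forall a f, I f -> I (a * f)].

Lemma ideal_sum I (T : Type) (r : seq T) (Q : pred T) (F : T -> R) :
  is_ideal I -> (forall i, Q i -> I (F i)) -> I (\sum_(i <- r | Q i) F i).
Proof. by case=> I0 ID _ IF; apply: big_ind. Qed.

Lemma gen_ideal_sub (S I : set R) : is_ideal I -> S `<=` I -> gen_ideal S `<=` I.
Proof.
move=> hI SI f [k [a [b [hb ->]]]]; apply: ideal_sum => // i _.
by case: hI => _ _; apply; apply: SI.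
Qed.

Lemma gen_ideal_in (S : set R) f : S f -> gen_ideal S f.
Proof.
move=> Sf; exists 1%N, (fun=> 1), (fun=> f); split=> //.
by rewrite big_ord1 mul1r.
Qed.

Lemma gen_ideal_ideal (S : set R) : is_ideal (gen_ideal S).
Proof.
split.
- by exists 0%N, (fun=> 0), (fun=> 0); split=> [[]//|]; rewrite big_ord0.
- move=> f g [k [a [b [hb ->]]]] [l [c [d [hd ->]]]].
  exists (k + l)%N, (fun i => match split i with inl i => a i | inr i => c i end),
     (fun i => match split i with inl i => b i | inr i => d i end); split.
    by move=> i; case: (split i).
  rewrite big_split_ord; congr (_ + _); apply: eq_bigr => i _.
    by rewrite -[lshift _ _]/(unsplit (inl i)) unsplitK.
  by rewrite -[rshift _ _]/(unsplit (inr i)) unsplitK.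
- move=> e f [k [a [b [hb ->]]]]; exists k, (fun i => e * a i), b; split=> //.
  by rewrite big_distrr /=; apply: eq_bigr => i _; rewrite mulrA.
Qed.

Lemma prime_idealP P : prime_ideal P <->
  [/\ is_ideal P, ~ P 1 & forall f g, P (f * g) -> P f \/ P g].
Proof.
split=> [[[P0 P1 PD] PM]|[[P0 PD PM] P1 Pp]].
  have {}P0 : P 0 by move: P0; rewrite inE.
  split.
  - split=> //.
      by move=> f g /mem_set Pf /mem_set Pg; have := PD 1 f g Pf Pg; rewrite mul1r inE.
    by move=> a f /mem_set Pf; have := PD a f 0 Pf (mem_set P0); rewrite addr0 inE.
  - by move=> /mem_set P1'; rewrite P1' in P1.
  - by move=> f g /mem_set /PM /orP [] ; rewrite inE; [left|right].
split.
  split; first exact: mem_set.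
    by apply/negP; rewrite inE.
  move=> a u v; rewrite !inE => Pu Pv; apply: PD => //; exact: PM.
by move=> f g; rewrite inE => /Pp [] h; apply/orP; [left|right]; apply: mem_set.
Qed.

Lemma prime_exp P f k : prime_ideal P -> P (f ^+ k) -> P f.
Proof.
move=> /prime_idealP [_ P1 Pp]; elim: k => [|k IHk]; first by rewrite expr0.
by rewrite exprS => /Pp [].
Qed.

Lemma prime_prod P (T : Type) (r : seq T) (Q : pred T) (F : T -> R) :
  prime_ideal P -> P (\prod_(i <- r | Q i) F i) -> exists2 i, Q i & P (F i).
Proof.
move=> /prime_idealP [_ P1 Pp]; elim: r => [|x r IHr]; first by rewrite big_nil.
rewrite big_cons; case: ifP => Qx; last exact: IHr.
by case/Pp=> [Px|/IHr//]; exists x.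
Qed.

End Ideals.

(** * Bound on chains of primes in a polynomial ring *)

Section Dimension.
Local Open Scope classical_set_scope.
Local Open Scope ring_scope.
Variables (K : fieldType) (n : nat).
Local Notation R := {mpoly K[n]}.

(* Values at y of nonzero polynomials in k variables, written from the lowest
   power of the first variable on. *)
Fixpoint nonzero_value (k : nat) (y : nat -> R) (f : R) : Prop :=
  match k with
  | 0 => exists2 c : K, c != 0 & f = c%:MP
  | k'.+1 => exists m g h, nonzero_value k' (fun i => y i.+1) g /\
                           f = y 0%N ^+ m * (g + y 0%N * h)
  end.

(** With m the least exponent of [y 0], the terms of exponent m give g by induction and the others
    carry a further factor [y 0]. Distinct exponent vectors prevent cancellation. *)
Lemma nonzero_value_sum (k : nat) (y : nat -> R) (T : finType) (D : {pred T})
    (c : T -> K) (e : T -> nat -> nat) :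
  (exists t, t \in D) -> {in D, forall t, c t != 0} ->
  {in D &, forall t u, (forall i, (i < k)%N -> e t i = e u i) -> t = u} ->
  nonzero_value k y (\sum_(t in D) c t *: \prod_(i < k) y i ^+ e t i).
Proof.
elim: k y D e => [|k IHk] y D e [t0 Dt0] cD eD /=.
  exists (c t0); first exact: cD.
  rewrite (bigD1 t0) //= big_ord0 big1 ?addr0 -?mul_mpolyC ?mulr1 //.
  by move=> t /andP[Dt /eqP nt]; case: nt; apply: eD.
case: (arg_minnP (fun t => e t 0%N) Dt0) => t1 Dt1 t1min.
pose m := e t1 0%N; pose D' := [pred t in D | e t 0%N == m].
exists m, (\sum_(t in D') c t *: \prod_(i < k) y i.+1 ^+ e t i.+1).
exists (\sum_(t in D | e t 0%N != m)
   c t *: (y 0%N ^+ (e t 0%N - m.+1) * \prod_(i < k) y i.+1 ^+ e t i.+1)).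
split.
  apply: (IHk (fun i => y i.+1) D' (fun t i => e t i.+1)).
  - by exists t1; apply/andP; split.
  - by move=> t /andP[Dt _]; apply: cD.
  - move=> t u /andP[Dt /eqP et] /andP[Du /eqP eu] h; apply: eD => // -[_|i hi].
      by rewrite et eu.
    exact: h.
rewrite mulrDr (bigID (fun t => e t 0%N == m)) /=; congr (_ + _).
  rewrite big_distrr /=; apply: eq_bigr => t /andP[_ /eqP em].
  by rewrite big_ord_recl em scalerAr.
rewrite mulrA -exprSr big_distrr /=; apply: eq_bigr => t /andP[Dt em].
rewrite big_ord_recl -scalerAr mulrA -exprD; congr (_ *: (_ ^+ _ * _)).
have /= := t1min t Dt; rewrite -/m => h1; move/eqP: em => em; lia.
Qed.

(** If f were in [q 0], cancelling the power of [y 0], which is outside [q 0], and then using that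
    [y 0] is in [q 1] would put g in [q 1], against the claim for the shifted chain. *)
Lemma nonzero_value_notin (k : nat) (q : nat -> set R) (y : nat -> R) (f : R) :
  (forall i, (i <= k)%N -> prime_ideal (q i)) ->
  (forall i, (i < k)%N -> q i `<=` q i.+1) ->
  (forall i, (i < k)%N -> ~ q i (y i) /\ q i.+1 (y i)) ->
  nonzero_value k y f -> ~ q 0%N f.
Proof.
elim: k q y f => [|k IHk] q y f qp qS hy /=.
  case=> c c0 ->; have /prime_idealP [[_ _ qM] q1 _] := qp 0%N isT => qc; apply: q1.
  by rewrite -mpolyC1 -(mulVf c0) mpolyCM; apply: qM.
case=> m [g] [h] [hg ->] qf.
have /prime_idealP [[_ _ qM] q1 qpr] := qp 0%N isT.
have [qn0 qy0] := hy 0%N isT.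
have {}qf: q 0%N (g + y 0%N * h).
  by case: (qpr _ _ qf) => // /(prime_exp (qp 0%N isT)).
have q1g : q 1%N g.
  have /prime_idealP [[_ qD qM1] _ _] := qp 1%N isT.
  have -> : g = (g + y 0%N * h) + (- h) * y 0%N by rewrite mulNr [h * _]mulrC addrK.
  apply: qD; [exact: (qS 0%N isT) | exact: qM1].
apply: (IHk (fun i => q i.+1) (fun i => y i.+1) g) q1g => //.
- by move=> i hi; apply: qp.
- by move=> i hi; apply: qS.
- by move=> i hi; apply: hy.
Qed.

Lemma mdeg_prod (k : nat) (y : 'I_k -> R) (a : 'I_k -> nat) E N :
  (forall i m, m \in msupp (y i) -> (mdeg m <= E)%N) -> (forall i, (a i <= N)%N) ->
  forall m, m \in msupp (\prod_i y i ^+ a i) -> (mdeg m <= k * (N * E))%N.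
Proof.
move=> hy ha.
have mulP d1 d2 (p1 p2 : R) : (forall m, m \in msupp p1 -> (mdeg m <= d1)%N) ->
   (forall m, m \in msupp p2 -> (mdeg m <= d2)%N) ->
   forall m, m \in msupp (p1 * p2) -> (mdeg m <= d1 + d2)%N.
  move=> h1 h2 m /msuppM_le /allpairsP [[m1 m2] /= [hm1 hm2 ->]].
  by rewrite mdegD leq_add ?h1 ?h2.
have oneP : forall m, m \in msupp (1 : R) -> (mdeg m <= 0)%N.
  by move=> m; rewrite msupp1 inE => /eqP ->; rewrite mdeg0.
have expP i b : forall m, m \in msupp (y i ^+ b) -> (mdeg m <= b * E)%N.
  elim: b => [|b IHb]; first by rewrite expr0 mul0n.
  by rewrite exprS mulSn; apply: mulP => //; apply: hy.
elim: k y a hy ha expP => [|k IHk] y a hy ha expP.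
  by rewrite big_ord0.
rewrite big_ord_recl mulSn; apply: mulP; last first.
  apply: (IHk (fun i => y (lift ord0 i)) (fun i => a (lift ord0 i))) => [i||i].
  - exact: hy.
  - by move=> i; apply: ha.
  - exact: expP.
move=> m /expP /leq_trans; apply; by rewrite leq_mul2r ha orbT.
Qed.

(** The N^(n + 1) products with exponents below N lie in the span of B^n monomials. For N large
    there are more products than monomials, and a left kernel vector of the coefficient matrix is a
    relation. *)
Lemma mpoly_alg_dep (y : 'I_n.+1 -> R) :
  exists (N : nat) (c : {ffun 'I_n.+1 -> 'I_N} -> K),
    (exists t, c t != 0) /\ \sum_t c t *: \prod_i y i ^+ t i = 0.
Proof.
pose E := \max_i msize (y i).
have hE i m : m \in msupp (y i) -> (mdeg m <= E)%N.
  move=> /msize_mdeg_lt/ltnW/leq_trans; apply.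
  exact: (leq_bigmax_cond (F := fun i => msize (y i)) i).
(* B below is at most N((n + 1)E + 1), so B^n < N^(n + 1) as soon as N exceeds ((n + 1)E + 1)^n. *)
pose N := ((n.+1 * E).+1 ^ n).+1; exists N.
pose B := (n.+1 * (N * E)).+1.
pose T := {ffun 'I_n.+1 -> 'I_N}; pose U := {ffun 'I_n -> 'I_B}.
pose pr (t : T) : R := \prod_i y i ^+ t i.
pose A := \matrix_(i < #|T|, j < #|U|)
   (pr (enum_val i))@_([multinom (enum_val j l : nat) | l < n]).
have ltUT : (#|U| < #|T|)%N.
  rewrite !card_ffun !card_ord expnS.
  apply: (@leq_ltn_trans ((N * (n.+1 * E).+1) ^ n)).
    have hB : (B <= N * (n.+1 * E).+1)%N by rewrite /B /N mulnCA mulnS; lia.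
    by case: (posnP n) => [->|n0]; rewrite ?expn0 // leq_exp2r.
  rewrite expnMn mulnC ltn_pmul2r ?expn_gt0 //.
have : kermx A != 0.
  rewrite -mxrank_eq0 mxrank_ker -lt0n subn_gt0.
  exact: leq_ltn_trans (rank_leq_col _) ltUT.
case/rowV0Pn => v /sub_kermxP vA v0.
exists (fun t => v 0 (enum_rank t)); split.
  case/rV0Pn: v0 => j vj; exists (enum_val j); by rewrite enum_valK.
apply/mpolyP => m; rewrite mcoeff0 raddf_sum /=.
case: (boolP [forall l, (m l < B)%N]) => [/forallP mB|].
  pose u : U := [ffun l => Ordinal (mB l)].
  have := congr1 (fun w : 'rV_ _ => w 0 (enum_rank u)) vA;
    rewrite mxE [RHS]mxE => h; apply: etrans h.
  rewrite (reindex (fun i : 'I_#|T| => enum_val i)) /=; last first.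
    exact: onW_bij (enum_val_bij _).
  apply: eq_bigr => i _; rewrite mcoeffZ !mxE enum_valK; congr (_ * _@_ _).
  by apply/mnmP => l; rewrite mnmE enum_rankK ffunE.
rewrite negb_forall => /existsP [l]; rewrite -leqNgt => hl.
apply: big1 => t _; rewrite mcoeffZ memN_msupp_eq0 ?mulr0 //.
apply/negP => /(mdeg_prod hE (N := N)) h.
have : (mdeg m <= n.+1 * (N * E))%N by apply: h => i; apply: ltnW.
rewrite leqNgt => /negP; apply; apply: leq_trans hl _.
by rewrite mdegE (bigD1 l) //= leq_addr.
Qed.

(** In a longer chain, elements picked from the successive differences satisfy a relation, which
    makes 0 a [nonzero_value] and puts it outside [q 0]. *)
Lemma prime_chain_le (P : set R) d : prime_chain P d -> (d <= n)%N.
Proof.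
case=> q [qp qS _]; rewrite leqNgt; apply/negP => nd.
have /choice [y hy] : forall i, exists f : R, (i < d)%N -> ~ q i f /\ q i.+1 f.
  move=> i; case: (ltnP i d) => [id|_]; last by exists 0.
  have [_ /existsNP [f /not_implyP [h1 h2]]] := qS i id.
  by exists f.
have [N [c [[t0 ct0] hc]]] := mpoly_alg_dep (fun i : 'I_n.+1 => y i).
have : ~ q 0%N (\sum_(t : {ffun 'I_n.+1 -> 'I_N} | c t != 0)
          c t *: \prod_(i < n.+1) y i ^+ (if insub (i : nat) is Some j then t j else 0%N)).
  apply: (@nonzero_value_notin n.+1 q y).
  - by move=> i hi; apply: qp; apply: leq_trans nd.
  - by move=> i hi; case: (qS i (leq_trans hi nd)).
  - by move=> i hi; apply: hy; apply: leq_trans nd.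
  pose e (t : {ffun 'I_n.+1 -> 'I_N}) (i : nat) : nat := if insub i is Some j then t j else 0%N.
  apply: (@nonzero_value_sum n.+1 y _ (fun t => c t != 0) c e) => //; first by exists t0.
  move=> t u _ _ h; apply/ffunP => i; apply/val_inj.
  by have := h i (ltn_ord i); rewrite /e valK.
have -> : (\sum_(t : {ffun 'I_n.+1 -> 'I_N} | c t != 0)
          c t *: \prod_(i < n.+1) y i ^+ (if insub (i : nat) is Some j then t j else 0%N)) = 0.
  apply: etrans hc; rewrite [RHS](bigID (fun t => c t != 0)) /= [X in _ = _ + X]big1 ?addr0.
    apply: eq_bigr => t _; congr (_ *: _); apply: eq_bigr => i _; by rewrite valK.
  by move=> t /negbNE/eqP ->; rewrite scale0r.
by apply; have /prime_idealP [[]] := qp 0%N isT.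
Qed.

End Dimension.

(** * Monomial ideals and primes generated by variables *)

Section Monomial.
Local Open Scope classical_set_scope.
Local Open Scope ring_scope.
Variables (K : fieldType) (n : nat).
Local Notation R := {mpoly K[n]}.
Implicit Types (A B : 'X_{1..n} -> Prop) (S : {set 'I_n}) (H : {set 'I_n} -> Prop).
Implicit Types (I P : set R) (f g : R) (m : 'X_{1..n}).

Definition monideal A : set R := [set f | forall m, m \in msupp f -> A m].
Definition upward A := forall m m', A m -> A (m + m')%MM.

Lemma monideal_X A m : monideal A 'X_[m] <-> A m.
Proof.
split=> [|Am m']; first by apply; rewrite msuppX mem_head.
by rewrite msuppX inE => /eqP ->.
Qed.

Lemma monideal_ideal A : upward A -> is_ideal (monideal A).
Proof.
move=> Aup; split.
- by move=> m; rewrite msupp0.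
- by move=> f g hf hg m /msuppD_le; rewrite mem_cat => /orP[/hf|/hg].
- move=> a f hf m /msuppM_le /allpairsP [[m1 m2] /= [_ /hf h ->]].
  by rewrite addmC; apply: Aup.
Qed.

Lemma ideal_scale I c f : is_ideal I -> I f -> I (c *: f).
Proof. by case=> _ _ IM If; rewrite -mul_mpolyC; apply: IM. Qed.

Lemma monideal_sub I A : is_ideal I -> (forall m, A m -> I 'X_[m]) -> monideal A `<=` I.
Proof.
move=> hI AI f hf; rewrite (mpolyE f) big_seq_cond.
apply: ideal_sum => // m /andP[hm _].
by apply: ideal_scale => //; apply/AI/hf.
Qed.

Lemma gen_ideal_eq_monideal (T : set R) A : upward A -> T `<=` monideal A ->
  (forall m, A m -> gen_ideal T 'X_[m]) -> gen_ideal T = monideal A.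
Proof.
move=> Aup TA AT; apply/seteqP; split.
  exact: gen_ideal_sub (monideal_ideal Aup) TA.
exact: monideal_sub (gen_ideal_ideal _) AT.
Qed.

Lemma ideal_lepm I m m' : is_ideal I -> I 'X_[m] -> (m <= m')%MM -> I 'X_[m'].
Proof.
case=> _ _ IM Im /submK <-; rewrite mpolyXD; exact: IM.
Qed.

Definition hits m S := exists2 i, i \in S & (0 < m i)%N.
Definition covers H m := forall S, H S -> hits m S.
Definition wt S m := (\sum_(i in S) m i)%N.
Definition indic S : 'X_{1..n} := [multinom (i \in S : nat) | i < n].

Lemma hits_up S : upward (hits^~ S).
Proof. by move=> m m' [i iS hi]; exists i; rewrite // mnmDE ltn_addr. Qed.

Lemma covers_up H : upward (covers H).
Proof. by move=> m m' h S /h; apply: hits_up. Qed.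

Lemma hits_wt S m : hits m S <-> (1 <= wt S m)%N.
Proof.
split=> [[i iS hi]|].
  by rewrite /wt (bigD1 i) //= ltn_addr.
apply: contraPP => h; apply/negP; rewrite -leqNgt leqn0 sum_nat_eq0.
apply/forall_inP => i iS; rewrite -leqn0 leqNgt; apply/negP => hi; apply: h.
by exists i.
Qed.

Definition varideal S : set R := monideal (hits^~ S).
(** The s-th power of the prime generated by the variables in [S]. *)
Definition wtideal S s : set R := monideal (fun m => (s <= wt S m)%N).

Lemma varideal_wt S : varideal S = wtideal S 1.
Proof. by apply/seteqP; split=> f h m /h /hits_wt. Qed.

Lemma monideal_covers H f : monideal (covers H) f <-> forall S, H S -> varideal S f.
Proof.
split=> [h S HS m /h|h m mf S /h]; first exact.
exact.
Qed.

(* x_i |-> x_i T for i in S: the T-adic order of the image is the S-order. *)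
Definition grading S : R -> {poly R} :=
  mmap (polyC \o @mpolyC n K) (fun i => if i \in S then ('X_i)%:P * 'X else ('X_i)%:P).

Lemma gradingM S f g : grading S (f * g) = grading S f * grading S g.
Proof. exact: rmorphM. Qed.

Lemma mmap1_grading S m :
  mmap1 (fun i => if i \in S then ('X_i : R)%:P * 'X else ('X_i)%:P) m =
  ('X_[m])%:P * 'X^(wt S m).
Proof.
rewrite /mmap1 mpolyXE_id rmorph_prod /wt -prodrXr [\prod_(i in S) _]big_mkcond.
rewrite -big_split /=; apply: eq_bigr => i _; rewrite rmorphXn /=; case: ifP => _.
  by rewrite exprMn.
by rewrite mulr1.
Qed.

(** The component of [f] of S-degree k, where variables in [S] have degree 1 and the others degree
    0. *)
Definition grading_coef S f k : R := (grading S f)`_k.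

Lemma grading_coefM S f g k :
  grading_coef S (f * g) k = \sum_(i < k.+1) grading_coef S f i * grading_coef S g (k - i)%N.
Proof. by rewrite /grading_coef gradingM coefM. Qed.

Lemma mcoeff_grading S f k m : (grading_coef S f k)@_m = if wt S m == k then f@_m else 0.
Proof.
have E m' : ((polyC \o @mpolyC n K) f@_m' *
    mmap1 (fun i => if i \in S then ('X_i : R)%:P * 'X else ('X_i)%:P) m')`_k@_m =
    if (m' == m) && (wt S m == k) then f@_m else 0.
  rewrite mmap1_grading /= mulrA -polyCM coefCM coefXn mul_mpolyC -scalerAl mcoeffZ.
  rewrite mulr_natr mcoeffMn mcoeffX; case: eqP => [->|_] /=; last by rewrite mul0rn mulr0.
  by rewrite [k == _]eq_sym; case: eqP => _; rewrite ?mulr1n ?mulr1 ?mulr0.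
rewrite /grading_coef /grading /mmap coef_sum raddf_sum /=; under eq_bigr do rewrite E.
case: (boolP (m \in msupp f)) => mf.
  rewrite (bigD1_seq m) ?msupp_uniq //= eqxx big1 ?addr0 //.
  by move=> m' /negPf ->.
rewrite (memN_msupp_eq0 mf) if_same big1 // => m' _.
by rewrite if_same.
Qed.

Lemma wtidealP S s f : wtideal S s f <-> forall k, (k < s)%N -> grading_coef S f k = 0.
Proof.
split=> [h k ks|h m].
  apply/mpolyP => m; rewrite mcoeff_grading mcoeff0; case: eqP => // hm.
  by apply/eqP; rewrite mcoeff_eq0; apply/negP => /h; rewrite hm leqNgt ks.
rewrite mcoeff_msupp leqNgt; apply: contraNN => /h /(congr1 (mcoeff m)).
by rewrite mcoeff_grading eqxx mcoeff0 => ->.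
Qed.

(** [g] has a nonzero component of S-degree 0; its product with the lowest component of [f] is the
    lowest component of [f * g], nonzero in a domain. *)
Lemma wtideal_cancel S s f g : ~ varideal S g -> wtideal S s (f * g) -> wtideal S s f.
Proof.
rewrite varideal_wt => /wtidealP hg /wtidealP h; apply/wtidealP.
have {hg} g0 : grading_coef S g 0 != 0.
  by apply: contra_notN hg => /eqP h0 [|].
elim/ltn_ind=> k IHk ks; have := h k ks; rewrite grading_coefM big_ord_recr /= subnn.
rewrite big1 => [|i _]; last first.
  by rewrite (IHk i (ltn_ord i) (ltn_trans (ltn_ord i) ks)) mul0r.
by move/eqP; rewrite add0r mulf_eq0 (negPf g0) orbF => /eqP.
Qed.

Lemma varideal_prime S : prime_ideal (varideal S).
Proof.
apply/prime_idealP; split.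
- exact: monideal_ideal (@hits_up S).
- by move=> /(_ 0%MM); rewrite msupp1 mem_head => /(_ isT) [i _]; rewrite mnm0E.
- move=> f g; rewrite {1}varideal_wt => h; case: (pselect (varideal S g)) => hg; first by right.
  by left; rewrite varideal_wt; apply: wtideal_cancel h.
Qed.

Lemma varideal_X S i : varideal S 'X_i <-> i \in S.
Proof.
apply: iff_trans (monideal_X _ _) _; split=> [[j jS]|iS];
  last by exists i => //; rewrite mnm1E eqxx.
by rewrite mnm1E lt0b => /eqP ->.
Qed.

Lemma varideal_sub S I : is_ideal I -> (forall i, i \in S -> I 'X_i) -> varideal S `<=` I.
Proof.
move=> hI h; apply: monideal_sub => // m [i iS hi].
apply: (@ideal_lepm _ U_(i)%MM) => //; first exact: h.
by apply/mnm_lepP => j; rewrite mnm1E; case: eqP => // <-.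
Qed.

Lemma prod_mpolyX S : \prod_(i in S) 'X_i = 'X_[indic S] :> R.
Proof.
rewrite mpolyXE_id [LHS]big_mkcond; apply: eq_bigr => i _.
by rewrite mnmE; case: (i \in S); rewrite ?expr0 ?expr1.
Qed.

(** Otherwise every edge has a variable outside [P], so the product of all variables outside [P] is
    a cover and lies in the prime [P]. *)
Lemma prime_contains_varideal H P : prime_ideal P -> monideal (covers H) `<=` P ->
  exists2 S, H S & varideal S `<=` P.
Proof.
move=> Pp HP; apply: contrapT => hno.
have hX S : H S -> exists2 i, i \in S & ~ P 'X_i.
  move=> HS; apply: contrapT => h; apply: hno; exists S => //.
  apply: varideal_sub; first by have /prime_idealP [] := Pp.
  by move=> i iS; apply: contrapT => hi; apply: h; exists i.
pose N := [set i : 'I_n | `[< ~ P 'X_i >]]%SET.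
have : P (\prod_(i in N) 'X_i).
  rewrite prod_mpolyX; apply: HP; apply/monideal_X => S /hX [i iS hi].
  by exists i => //; rewrite mnmE inE; case: asboolP.
by case/(prime_prod Pp) => i; rewrite inE => /asboolP.
Qed.

Lemma varideal_mono S S' : S \subset S' -> varideal S `<=` varideal S'.
Proof.
move=> /fintype.subsetP SS; apply: varideal_sub; first exact: monideal_ideal (@hits_up S').
by move=> i /SS ?; apply/varideal_X.
Qed.

Lemma varideal_chain S0 S : (S0 :&: S)%SET = finset.set0 -> exists q : nat -> set R,
  [/\ forall i, prime_ideal (q i),
      forall i, (i < #|S|)%N -> q i `<` q i.+1, q 0%N = varideal S0
    & q #|S| = varideal (S0 :|: S)%SET].
Proof.
move=> dis; pose T i := (S0 :|: [set x in take i (enum S)])%SET.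
have hT i : (i < #|S|)%N -> exists2 x, x \in T i.+1 & x \notin T i.
  rewrite cardE => hi; have [x0 _] : exists x0, x0 \in S.
    by apply/card_gt0P; rewrite cardE; apply: leq_ltn_trans hi.
  exists (nth x0 (enum S) i); rewrite !inE.
    by rewrite (take_nth x0) // mem_rcons mem_head orbT.
  rewrite negb_or; apply/andP; split.
    apply/negP => h; have : nth x0 (enum S) i \in (S0 :&: S)%SET.
      by rewrite inE h -mem_enum mem_nth.
    by rewrite dis inE.
  have := enum_uniq S; rewrite -{1}(cat_take_drop i (enum S)) cat_uniq.
  case/and3P => _ /hasPn + _; apply.
  by rewrite (drop_nth x0) // mem_head.
exists (fun i => varideal (T i)); split.
- by move=> i; apply: varideal_prime.
- move=> i /hT [x h1 h2]; split.
    apply: varideal_mono; apply: finset.setUS; apply/fintype.subsetP => y; rewrite !inE.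
    by move=> h; apply: (mem_take (n0 := i)); rewrite take_takel.
  by move=> /(_ 'X_x) h; move/negP: h2; apply; apply/varideal_X/h/varideal_X.
- by congr varideal; apply/finset.setP => x; rewrite !inE take0 orbF.
- congr varideal; apply/finset.setP => x; rewrite !inE take_oversize ?mem_enum //.
  by rewrite cardE.
Qed.

(** Adding the variables of [S] one at a time gives a chain of primes; its top is replaced by
    [P]. *)
Lemma varideal_prime_chain S P : prime_ideal P -> varideal S `<=` P -> prime_chain P #|S|.
Proof.
move=> Pp SP; have [|q [qp qS q0]] := @varideal_chain finset.set0 S.
  exact: finset.set0I.
rewrite finset.set0U => qe.
exists (fun i => if i == #|S| then P else q i); split.
- by move=> i _; case: eqP.
- move=> i hi; rewrite (ltn_eqF hi); case: eqP => [e|_]; last exact: qS.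
  have [h1 h2] := qS i hi; rewrite e qe in h1 h2; split.
    by move=> f /h1 /SP.
  by move=> h; apply: h2 => f /SP /h.
- by rewrite eqxx.
Qed.

(** A chain ending at this prime can be continued by adding the remaining variables one at a time,
    and the total length is at most n. *)
Lemma varideal_height S : prime_height (varideal S) #|S|.
Proof.
split; first exact: varideal_prime_chain (varideal_prime S) _.
move=> d [q [qp qS qd]].
have [|r [rp rS r0 re]] := @varideal_chain S (~: S)%SET.
  exact: finset.setICr.
have := @prime_chain_le K n (r #|~: S|%SET) (d + #|~: S|%SET)%N.
suff H : prime_chain (r #|~: S|%SET) (d + #|~: S|%SET).
  move=> /(_ H); have := cardsC S; rewrite card_ord; lia.
exists (fun i => if (i <= d)%N then q i else r (i - d)%N); split.
- by move=> i _; case: ifP => // h; apply: qp.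
- move=> i hi; case: (ltngtP i d) => h.
  + exact: qS.
  + rewrite subSn 1?ltnW //; apply: rS; move: hi h; lia.
  + rewrite h qd -r0 subSnn; apply: rS; move: hi h; lia.
- case: ifP => h; last by rewrite addKn.
  have e : #|~: S|%SET = 0%N by move: h; lia.
  by rewrite e addn0 qd r0.
Qed.

End Monomial.

Arguments monideal K {n} A.
Arguments varideal K {n} S.
Arguments wtideal K {n} S s.

(** * From ideals to clutters *)

Section Translation.
Local Open Scope classical_set_scope.
Local Open Scope ring_scope.
Variables (K : fieldType) (n : nat).
Local Notation R := {mpoly K[n]}.
Implicit Types (A B : 'X_{1..n} -> Prop) (S : {set 'I_n}) (H : {set 'I_n} -> Prop).
Implicit Types (I P : set R) (f g : R) (m : 'X_{1..n}).

Lemma indic_le S m : (indic S <= m)%MM <-> forall i, i \in S -> (0 < m i)%N.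
Proof.
split=> [/mnm_lepP h i iS|h]; first by have := h i; rewrite mnmE iS.
by apply/mnm_lepP => i; rewrite mnmE; case: (boolP (i \in S)) => // /h.
Qed.

Lemma indic_subset S S' : (indic S <= indic S')%MM -> S \subset S'.
Proof.
move/indic_le => h; apply/fintype.subsetP => i /h.
by rewrite mnmE lt0b.
Qed.

Lemma t_connected_idealE t (G : rel 'I_n) : t_connected_ideal K t G =
  monideal K (fun m => exists2 S, conn_edge t G S & (indic S <= m)%MM).
Proof.
apply: gen_ideal_eq_monideal.
- by move=> m m' [S hS h]; exists S => //; apply: lepm_trans h (lem_addr _ _).
- move=> f [S [hS cS ->]]; rewrite prod_mpolyX; apply/monideal_X.
  by exists S => //; apply: lepm_refl.
- move=> m [S [hS cS] h]; apply: ideal_lepm h; first exact: gen_ideal_ideal.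
  by apply: gen_ideal_in; exists S; rewrite prod_mpolyX.
Qed.

(** All edges have t vertices, so no generator properly divides another. *)
Lemma min_monomialsE t (G : rel 'I_n) m :
  min_monomials (t_connected_ideal K t G) m <-> exists2 S, conn_edge t G S & m = indic S.
Proof.
rewrite /min_monomials t_connected_idealE; split=> [[/monideal_X [S hS h] hmin]|[S hS ->]].
  exists S => //; apply/esym/hmin => //; apply/monideal_X; exists S => //; exact: lepm_refl.
split; first by apply/monideal_X; exists S => //; apply: lepm_refl.
move=> m' /monideal_X [S' hS' h] h'.
have e : S' = S.
  have /indic_subset sub := lepm_trans h h'; apply/eqP; rewrite eqEcard sub.
  by case: hS hS' => -> _ [-> _] /=.
subst S'; apply/mnmP => i; apply/anti_leq.
by move/mnm_lepP: h => ->; move/mnm_lepP: h' => ->.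
Qed.

Lemma J_monideal t (G : rel 'I_n) : J K t G = monideal K (covers (conn_edge t G)).
Proof.
have hP S : gen_ideal [set f : R | exists2 j : 'I_n, (0 < indic S j)%N & f = 'X_j] = varideal K S.
  apply: gen_ideal_eq_monideal; first exact: hits_up.
    move=> f [j]; rewrite mnmE lt0b => jS ->; exact/varideal_X.
  move=> m [i iS hi]; apply: (@ideal_lepm _ _ _ U_(i)%MM); first exact: gen_ideal_ideal.
    by apply: gen_ideal_in; exists i; rewrite // mnmE iS.
  by apply/mnm_lepP => j; rewrite mnm1E; case: eqP => // <-.
apply/seteqP; split=> f.
  move=> h; apply/monideal_covers => S hS; rewrite -hP; apply: (h (indic S)).
  by apply/min_monomialsE; exists S.
by move=> /monideal_covers h _ /min_monomialsE [S hS ->]; rewrite hP; apply: h.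
Qed.

Section SetVars.
Variable v : 'I_n -> option bool.
Local Notation tup := [tuple if v i is Some b then b%:R else 'X_i : R | i < n].

Lemma setvars_X m : 'X_[m] \mPo tup =
  if [exists i, (v i == Some false) && (0 < m i)%N] then 0
  else 'X_[ [multinom (if v i == None then m i else 0%N) | i < n] ].
Proof.
rewrite comp_mpolyX; case: ifP => [/existsP [i /andP [/eqP vi hi]]|/negbT].
  by rewrite (bigD1 i) //= tnth_mktuple vi expr0n eqn0Ngt hi mul0r.
rewrite negb_exists => /forallP h; rewrite mpolyXE_id; apply: eq_bigr => i _.
have := h i; rewrite tnth_mktuple mnmE; case: (v i) => [[]|] //=.
  by rewrite expr1n expr0.
by rewrite -leqNgt leqn0 => /eqP ->; rewrite !expr0.
Qed.

Lemma set_vars_monideal H : set_vars v (monideal K (covers H)) = monideal K (covers (minor v H)).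
Proof.
apply: gen_ideal_eq_monideal; first exact: covers_up.
  move=> _ [f hf <-]; rewrite comp_mpolyEX.
  have hI := monideal_ideal K (@covers_up n (minor v H)).
  rewrite big_seq_cond; apply: ideal_sum => // m /andP[/hf hm _].
  apply: (@ideal_scale K n _ _ _ hI); rewrite setvars_X; case: ifP => [_|/negbT].
    by case: hI.
  rewrite negb_exists => /forallP hz; apply/monideal_X => _ [S [HS hS ->]].
  have [i iS hi] := hm S HS; exists i; last first.
    rewrite mnmE; have := hz i; have := hS i iS; case: (v i) => [[]|] //=.
    by rewrite hi.
  rewrite inE iS; have := hz i; have := hS i iS; case: (v i) => [[]|] //=.
  by rewrite hi.
move=> m hm.
(* Exponent 1 at variables set to 1 hits the edges deleted in the minor; exponent 0 at variables set
   to 0 keeps the substituted monomial from vanishing. *)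
pose m' : 'X_{1..n} := [multinom (if v i is Some b then b : nat else m i) | i < n].
have hm' : covers H m'.
  move=> S HS; case: (pselect (exists2 i, i \in S & v i = Some true)) => [[i iS vi]|hno].
    by exists i; rewrite // mnmE vi.
  have [|i] := hm [set i in S | v i == None]%SET.
    by exists S; split=> // i iS vi; apply: hno; exists i.
  rewrite inE => /andP [iS /eqP vi] hi; exists i => //; by rewrite mnmE vi.
apply: (@ideal_lepm _ _ _ [multinom (if v i == None then m i else 0%N) | i < n]).
- exact: gen_ideal_ideal.
- apply: gen_ideal_in; exists 'X_[m']; first exact/monideal_X.
  rewrite setvars_X ifF.
    by congr 'X_[_]; apply/mnmP => i; rewrite !mnmE; case: (v i).
  by apply/negbTE; rewrite negb_exists; apply/forallP => i; rewrite mnmE; case: (v i) => [[]|].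
- by apply/mnm_lepP => i; rewrite mnmE; case: ifP.
Qed.

End SetVars.

Lemma gen_mons (s : seq 'X_{1..n}) :
  gen_ideal [set` [seq 'X_[K, m] | m <- s]] =
  monideal K (fun m => exists2 m0, m0 \in s & (m0 <= m)%MM).
Proof.
apply: gen_ideal_eq_monideal.
- by move=> m m' [m0 hS h]; exists m0 => //; apply: lepm_trans h (lem_addr _ _).
- by move=> f /= /mapP [m hm ->]; apply/monideal_X; exists m => //; apply: lepm_refl.
- move=> m [m0 hS h]; apply: ideal_lepm h; first exact: gen_ideal_ideal.
  by apply: gen_ideal_in => /=; apply: map_f.
Qed.

(** Multiplication by a monomial only shifts supports, so regularity can be tested on monomials,
    where membership is divisibility by an earlier term. *)
Lemma regular_monP (s : seq 'X_{1..n}) :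
  regular_sequence [seq 'X_[K, m] | m <- s] <->
  (forall i m, (i < size s)%N -> (exists2 m0, m0 \in take i s & (m0 <= m + nth 0%MM s i)%MM) ->
     exists2 m0, m0 \in take i s & (m0 <= m)%MM) /\ 0%MM \notin s.
Proof.
rewrite /regular_sequence gen_mons; split=> [[hr h1]|[hr h1]].
  split.
    move=> i m hi h; have := hr i 'X_[m].
    rewrite size_map -map_take gen_mons (nth_map 0%MM) // -mpolyXD => /(_ hi) hX.
    pose A m1 := exists2 m0, m0 \in take i s & (m0 <= m1)%MM.
    by apply/(@monideal_X K n A)/hX/monideal_X.
  apply/negP => h; apply: h1; rewrite -mpolyX0; apply/monideal_X.
  by exists 0%MM => //; apply: lepm_refl.
split.
  move=> i g; rewrite size_map -map_take gen_mons => hi; rewrite (nth_map 0%MM) // => h m hm.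
  apply: hr (hi) _ => //; apply: h.
  by rewrite mcoeff_msupp addmC mcoeffMX -mcoeff_msupp.
rewrite -mpolyX0 => /monideal_X [m0 hm0 /mnm_lepP h]; move/negP: h1; apply.
suff -> : 0%MM = m0 by [].
by apply/mnmP => i; apply/esym/eqP; have := h i; rewrite mnm0E leqn0.
Qed.

Definition coprimem (m m' : 'X_{1..n}) := forall i, (0 < m i)%N -> m' i = 0%N.

(** If m_j shared x_l with an earlier m_i, its product with m_i / x_l would be a multiple of m_i; by
    regularity a term before m_j divides m_i / x_l, and it is a divisor of m_i other than m_i, which
    [nle] excludes. *)
Lemma regular_coprime (s : seq 'X_{1..n}) :
  regular_sequence [seq 'X_[K, m] | m <- s] ->
  forall i j, (i < j < size s)%N -> coprimem (nth 0%MM s i) (nth 0%MM s j).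
Proof.
move=> /regular_monP [hr h0] i j /andP [ij js] l hl.
have is_ : (i < size s)%N by apply: ltn_trans js.
pose mi := nth 0%MM s i; pose mj := nth 0%MM s j; rewrite -/mj.
(* Suppose m_k divides m_i. If k < i, regularity at m_i applied to 1 makes some term 1; if k > i,
   regularity at m_k applied to m_i / m_k yields an earlier divisor of m_i or m_k = 1. *)
have nle k : (k < size s)%N -> k != i -> ~ (nth 0%MM s k <= mi)%MM.
  elim/ltn_ind: k => k IHk ks ki hk; case: (ltngtP k i) ki => // ki _.
    have [|m0] := hr i 0%MM is_.
      exists (nth 0%MM s k); first by rewrite -(nth_take _ ki) mem_nth // size_take is_.
      by rewrite add0m.
    move=> hm0 /mnm_lepP h; move/negP: h0; apply; rewrite (_ : 0%MM = m0);
      first exact: mem_take hm0.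
    by apply/mnmP => l'; apply/esym/eqP; have := h l'; rewrite mnm0E leqn0.
  have [|m0] := hr k (mi - nth 0%MM s k)%MM ks.
    exists mi; first by rewrite /mi -(nth_take _ ki) mem_nth // size_take ks.
    by rewrite submK // lepm_refl.
  move=> /(nthP 0%MM) [k' hk' <-].
  have k'k : (k' < k)%N by move: hk'; rewrite size_take ks.
  rewrite nth_take //; case: (eqVneq k' i) => [->|k'i] h.
    move/negP: h0; apply; rewrite (_ : 0%MM = nth 0%MM s k); first exact: mem_nth.
    apply/mnmP => l'; move/mnm_lepP: h => /(_ l'); move/mnm_lepP: hk => /(_ l').
    by rewrite -/mi mnmBE mnm0E; lia.
  apply: (IHk k' k'k (ltn_trans k'k ks) k'i).
  apply: lepm_trans h _; apply/mnm_lepP => l'; rewrite mnmBE; exact: leq_subr.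
apply/eqP; rewrite -leqn0 leqNgt; apply/negP => hj.
have [|m0] := hr j (mi - U_(l))%MM js.
  exists mi; first by rewrite /mi -(nth_take _ ij) mem_nth // size_take js.
  apply/mnm_lepP => l'; rewrite mnmDE mnmBE mnm1E -/mj; case: eqP => [<-|_]; lia.
move=> /(nthP 0%MM) [k hk <-].
have kj : (k < j)%N by move: hk; rewrite size_take js.
rewrite nth_take //; case: (eqVneq k i) => [->|ki] h.
  move/mnm_lepP: h => /(_ l); rewrite -/mi mnmBE mnm1E eqxx -/mi; move: hl; rewrite -/mi; lia.
apply: (nle k (ltn_trans kj js) ki); apply: lepm_trans h _.
by apply/mnm_lepP => l'; rewrite mnmBE leq_subr.
Qed.

Lemma coprime_regular (s : seq 'X_{1..n}) : 0%MM \notin s ->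
  (forall i j, (i < j < size s)%N -> coprimem (nth 0%MM s i) (nth 0%MM s j)) ->
  regular_sequence [seq 'X_[K, m] | m <- s].
Proof.
move=> s0 hs; apply/regular_monP; split=> // i m hi [m0 hm0 h]; exists m0 => //.
case/(nthP 0%MM): hm0 => k; rewrite size_take hi => ki e.
move: e h; rewrite nth_take // => <- /mnm_lepP h.
apply/mnm_lepP => l; have := h l; rewrite mnmDE.
case: (posnP (nth 0%MM s k l)) => [->//|hl]; rewrite (hs k i) ?addn0 //.
by rewrite ki hi.
Qed.

Lemma height_covers H S : H S -> (forall S', H S' -> (#|S| <= #|S'|)%N) ->
  height (monideal K (covers H)) #|S|.
Proof.
move=> HS hmin; split.
  exists (varideal K S); split; [exact: varideal_prime | | exact: varideal_height].
  by move=> f /monideal_covers; apply.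
move=> P d Pp HP [_ Pd]; have [S' HS' S'P] := prime_contains_varideal Pp HP.
by apply: leq_trans (hmin S' HS') _; apply/Pd/varideal_prime_chain.
Qed.

(** The terms of a regular sequence of monomials have disjoint supports, which serve as colour
    classes; conversely the squarefree monomials of the classes are pairwise coprime covers. *)
Lemma konig_monideal H : konig (monideal K (covers H)) <->
  forall S, H S -> (forall S', H S' -> (#|S| <= #|S'|)%N) -> colorable H #|S|.
Proof.
split=> [hk S HS hmin|hcol c [[P [Pp HP _]] hc]].
  have [s [sz sI /regular_coprime hreg]] := hk _ (height_covers HS hmin).
  (* On a vertex in no term, [find] returns the length of [s], which is not a colour below it. *)
  exists (fun i => find (fun m : 'X_{1..n} => (0 < m i)%N) s) => S' HS' k hk'.
  have ks : (k < size s)%N by rewrite sz.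
  have /monideal_X /(_ S' HS') [i iS hi] := sI _ (mem_nth 0%MM ks).
  exists i => //; apply/eqP; case: ltngtP => // h.
    have hf : (0 < nth 0%MM s (find (fun m : 'X_{1..n} => (0 < m i)%N) s) i)%N.
      apply: (nth_find 0%MM (a := fun m : 'X_{1..n} => (0 < m i)%N)).
      by rewrite has_find (ltn_trans h ks).
    by have := hreg _ _ (introT andP (conj h ks)) i hf; move: hi => /[swap] ->.
  by have := before_find 0%MM h; rewrite hi.
have [S0 HS0 _] := prime_contains_varideal Pp HP.
have [S HS hmin] : exists2 S, H S & forall S', H S' -> (#|S| <= #|S'|)%N.
  have hS0 : `[< H S0 >] by apply/asboolP.
  case: (arg_minnP (P := fun S => `[< H S >]) (fun S : {set 'I_n} => #|S|) hS0)
    => S /asboolP HS hmin.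
  by exists S => // S' HS'; apply: hmin; apply/asboolP.
have cS : (c <= #|S|)%N.
  apply: hc (varideal_height K S); first exact: varideal_prime.
  by move=> f /monideal_covers; apply.
have [col hcol'] := hcol S HS hmin.
pose cm k : 'X_{1..n} := [multinom ((col i == k) : nat) | i < n].
exists [seq cm k | k <- iota 0 c]; rewrite size_map size_iota; split=> //.
  move=> m /mapP [k]; rewrite mem_iota /= add0n => kc ->; apply/monideal_X => S' HS'.
  have [i iS ci] := hcol' S' HS' k (leq_trans kc cS).
  by exists i; rewrite // mnmE ci eqxx.
apply: coprime_regular.
  apply/mapP => -[k]; rewrite mem_iota /= add0n => kc /mnmP h.
  have [i iS ci] := hcol' S HS k (leq_trans kc cS).
  by have := h i; rewrite mnm0E mnmE ci eqxx.
rewrite size_map size_iota => i j /andP[ij jc] l.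
rewrite !(nth_map 0%N) ?size_iota ?(ltn_trans ij) // !nth_iota ?(ltn_trans ij) // !add0n.
by rewrite !mnmE lt0b => /eqP ->; rewrite ltn_eqF.
Qed.

Lemma packing_packed H : packing_property (monideal K (covers H)) <-> packed H.
Proof.
by split=> h v; have := h v; rewrite set_vars_monideal;
  [move/konig_monideal|move=> ?; apply/konig_monideal].
Qed.

(** * Ordinary and symbolic powers *)

Definition decomposes A s m := exists b : 'I_s -> 'X_{1..n},
  (forall k, A (b k)) /\ (\sum_k b k <= m)%MM.

Lemma decomposesS A s m0 m : A m0 -> decomposes A s m -> decomposes A s.+1 (m0 + m)%MM.
Proof.
move=> h0 [b [hb hm]].
exists (fun k => if unlift ord0 k is Some k' then b k' else m0); split.
  by move=> k; case: unliftP.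
rewrite big_ord_recl unlift_none; under eq_bigr do rewrite liftK.
by apply/mnm_lepP => i; rewrite !mnmDE leq_add2l; move/mnm_lepP: hm; apply.
Qed.

Lemma decomposes_le A s m m' : decomposes A s m -> (m <= m')%MM -> decomposes A s m'.
Proof. by case=> b [hb h] h'; exists b; split=> //; apply: lepm_trans h h'. Qed.

Lemma decomposes_prod A s (h : 'I_s -> R) : (forall i, monideal K A (h i)) ->
  monideal K (decomposes A s) (\prod_i h i).
Proof.
elim: s h => [|s IHs] h hh.
  move=> m _; exists (fun=> m); split=> [[]//|]; rewrite big_ord0.
  by apply/mnm_lepP => i; rewrite mnm0E.
rewrite big_ord_recl => m /msuppM_le /allpairsP [[m1 m2] /= [/hh h1 h2 ->]].
apply: decomposesS => //; apply: IHs h2 => i; exact: hh.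
Qed.

Lemma ideal_pow_monideal A s : upward A -> ideal_pow (monideal K A) s = monideal K (decomposes A s).
Proof.
move=> Aup; apply: gen_ideal_eq_monideal.
- by move=> m m' h; apply: decomposes_le h (lem_addr _ _).
- by move=> f [h hh ->]; apply: decomposes_prod.
- move=> m [b [hb hm]]; apply: ideal_lepm hm; first exact: gen_ideal_ideal.
  apply: gen_ideal_in; exists (fun k => 'X_[b k]); first by move=> k; apply/monideal_X.
  by rewrite (big_morph _ (@mpolyXD _ _) (@mpolyX0 _ _)).
Qed.

Lemma wtD S m m' : wt S (m + m')%MM = (wt S m + wt S m')%N.
Proof. by rewrite /wt -big_split; apply: eq_bigr => i _; rewrite mnmDE. Qed.

Lemma decomposes_wt H S s m : H S -> decomposes (covers H) s m -> (s <= wt S m)%N.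
Proof.
move=> HS [b [hb hm]]; apply: (@leq_trans (wt S (\sum_k b k)%MM)); last first.
  by apply: leq_sum => i _; move/mnm_lepP: hm.
rewrite (big_morph _ (@wtD S) (_ : wt S 0%MM = 0%N)); last first.
  by apply: big1 => i _; rewrite mnm0E.
rewrite -[X in (X <= _)%N]card_ord -sum1_card; apply: leq_sum => k _.
by apply/hits_wt/hb.
Qed.

(** For i in [S], x_i times the product of the variables outside [S] is a cover, since every other
    edge leaves [S]. One such cover is split off for each of s units of weight on [S]. *)
Lemma wt_decomposes H S s m : (forall S', H S' -> ~~ (S' \subset S) \/ S' = S) ->
  (s <= wt S m)%N -> decomposes (covers H) s (m + indic (~: S)%SET *+ s)%MM.
Proof.
move=> hH; elim: s m => [|s IHs] m hm.
  exists (fun=> m); split=> [[]//|]; rewrite big_ord0.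
  by apply/mnm_lepP => i; rewrite mnm0E.
have /hits_wt [i iS hi] : (1 <= wt S m)%N by apply: leq_trans hm.
have e : m = (U_(i) + (m - U_(i)))%MM.
  by rewrite addmC submK //; apply/mnm_lepP => j; rewrite mnm1E; case: eqP => // <-.
have -> : (m + indic (~: S)%SET *+ s.+1 =
   (U_(i) + indic (~: S)%SET) + ((m - U_(i)) + indic (~: S)%SET *+ s))%MM.
  by apply/mnmP => j; rewrite {1}e !(mnmDE, mulmS); lia.
apply: decomposesS.
  move=> S' HS'; case: (hH S' HS') => [/subsetPn [j jS' jS]|->].
    by exists j => //; rewrite mnmDE [indic _ _]mnmE inE jS addn1.
  by exists i; rewrite // mnmDE mnm1E eqxx.
apply: IHs; move: hm; rewrite {1}e wtD.
suff -> : wt S U_(i)%MM = 1%N by rewrite add1n.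
rewrite /wt (bigD1 i) //= mnm1E eqxx big1 // => j /andP [_ ji].
by rewrite mnm1E eq_sym (negPf ji).
Qed.

Section Symbolic.
Variables (H : {set 'I_n} -> Prop) (t : nat).
Hypothesis Ht : forall S, H S -> #|S| = t.
Local Notation I := (monideal K (covers H)).

Lemma edge_antichain S S' : H S -> H S' -> ~~ (S' \subset S) \/ S' = S.
Proof.
move=> /Ht hS /Ht hS'; case: (boolP (S' \subset S)) => sub; last by left.
by right; apply/eqP; rewrite eqEcard sub hS hS' /=.
Qed.

Lemma varideal_indicC S : ~ varideal K S 'X_[indic (~: S)%SET].
Proof. by move/monideal_X => [i iS]; rewrite mnmE inE iS. Qed.

(** The colon ideal of f is the cover ideal of the edges [S] with f outside [varideal S]; if prime,
    it equals one of these. Conversely, [varideal S] is the colon ideal of the product of the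
    variables outside [S]. *)
Lemma assoc_primesE P : assoc_primes I P <-> exists2 S, H S & P = varideal K S.
Proof.
split=> [[Pp [f hP]]|[S HS ->]].
  pose H' S := H S /\ ~ varideal K S f.
  have hP' : P = monideal K (covers H').
    rewrite hP; apply/seteqP; split=> g /=.
      move=> /monideal_covers h; apply/monideal_covers => S [HS fS].
      have /prime_idealP [_ _ Pr] := varideal_prime K S.
      by case: (Pr _ _ (h S HS)).
    move=> /monideal_covers h; apply/monideal_covers => S HS.
    have /prime_idealP [[_ _ PM] _ _] := varideal_prime K S.
    case: (pselect (varideal K S f)) => fS; first exact: PM.
    by rewrite mulrC; apply: PM; apply: h.
  have [|S [HS fS] hS] := @prime_contains_varideal K n H' P Pp; first by rewrite -hP'.
  exists S => //; apply/seteqP; split=> //.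
  by rewrite hP' => g /monideal_covers; apply.
split; first exact: varideal_prime.
exists 'X_[indic (~: S)%SET]; apply/seteqP; split=> g /=.
  move=> gS; apply/monideal_covers => S' HS'.
  have /prime_idealP [[_ _ PM] _ _] := varideal_prime K S'.
  case: (edge_antichain HS HS') => [/subsetPn [j jS' jS]|e].
    apply: PM; apply/monideal_X; exists j => //; by rewrite mnmE inE jS.
  by rewrite mulrC; apply: PM; rewrite e.
move=> /monideal_covers /(_ S HS); have /prime_idealP [_ _ Pr] := varideal_prime K S.
by case/Pr => // /varideal_indicC.
Qed.

Lemma symbolic_pow_monideal s :
  symbolic_pow I s = monideal K (fun m => forall S, H S -> (s <= wt S m)%N).
Proof.
have powE := ideal_pow_monideal s (@covers_up n H).
apply/seteqP; split=> f.
  move=> h.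
  suff hf S : H S -> wtideal K S s f by move=> m mf S HS; apply: hf.
  move=> HS; have /h /= [a [u [ha hu e]]] : assoc_primes I (varideal K S).
    by apply/assoc_primesE; exists S.
  have u0 : u != 0.
    by apply: contra_notN hu => /eqP ->; have /prime_idealP [[]] := varideal_prime K S.
  have {}e : f * u = a.
    by apply/eqP; rewrite -tofrac_eq tofracM e divfK // tofrac_eq0.
  apply: (@wtideal_cancel K n S s f u) => //; rewrite e => m ma.
  by apply: (decomposes_wt HS); move: ha; rewrite powE; apply.
move=> hf P /assoc_primesE [S HS ->] /=.
(* This denominator is outside [varideal S], and by [wt_decomposes] multiplying by it moves [f] into
   the ordinary power. *)
exists (f * 'X_[indic (~: S)%SET] ^+ s), ('X_[indic (~: S)%SET] ^+ s); split.
- rewrite powE mpolyXn => m.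
  rewrite (perm_mem (msuppMX _ _)) => /mapP [m' mf ->].
  rewrite addmC; apply: wt_decomposes; last exact: hf.
  by move=> S' HS'; apply: edge_antichain.
- by move=> /(prime_exp (varideal_prime K S)) /varideal_indicC.
- rewrite tofracM mulfK // tofrac_eq0 expf_neq0 //.
  by apply/eqP => e; apply: (@varideal_indicC S); rewrite e => m; rewrite msupp0.
Qed.

Lemma symbolic_mengerian : mengerian H <->
  forall s : nat, (1 <= s)%N -> symbolic_pow I s = ideal_pow I s.
Proof.
split=> [hM s _|h s a ha].
  rewrite symbolic_pow_monideal (ideal_pow_monideal _ (@covers_up n H)).
  apply/seteqP; split=> f hf m mf.
    have [b [hb hc]] := hM s m (hf m mf).
    exists (fun k => [multinom b k i | i < n]); split.
      by move=> k S HS; have [i iS hi] := hc k S HS; exists i; rewrite // mnmE.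
    apply/mnm_lepP => i; rewrite mnm_sumE; under eq_bigr do rewrite mnmE; exact: hb.
  by move=> S HS; apply: (decomposes_wt HS); apply: hf.
case: s ha => [|s] ha.
  by exists (fun _ _ => 0%N); split=> [i|[]//]; rewrite big_ord0.
pose m : 'X_{1..n} := [multinom a i | i < n].
have : symbolic_pow I s.+1 'X_[m].
  rewrite symbolic_pow_monideal; apply/monideal_X => S /ha; rewrite /wt.
  by under [X in _ -> (_ < X)%N]eq_bigr do rewrite mnmE.
rewrite h // (ideal_pow_monideal _ (@covers_up n H)) => /monideal_X [b [hb hm]].
exists (fun k => b k); split=> [i|k S HS]; last exact: hb.
by move/mnm_lepP: hm => /(_ i); rewrite mnm_sumE mnmE.
Qed.

End Symbolic.

End Translation.

Theorem theorem1p2 (K : fieldType) (n t : nat) (G : rel 'I_n)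
    (G_sym : symmetric G) (G_irr : irreflexive G)
    (G_conn : connected_graph G) (t_ge3 : (3 <= t)%N) (t_le_n : (t <= n)%N) :
  [<-> packing_property (J K t G);
       forall s : nat, (1 <= s)%N ->
         symbolic_pow (J K t G) s = ideal_pow (J K t G) s;
       [\/ n = t,
           (t <= n)%N /\ graph_iso G (path_graph n)
         | graph_iso G (cycle_graph n) /\
           [\/ t = 3 /\ n \in [:: 3; 6; 9],
               t = 4 /\ n \in [:: 4; 8]
             | (5 <= t)%N /\ n = t]]].
Proof.
have edge_card S : conn_edge t G S -> #|S| = t by case.
have sym_iff := symbolic_mengerian K edge_card.
have t_bd : 3 <= t <= n by rewrite t_ge3.
rewrite !J_monideal; tfae.
(* Packing yields equality of powers only by way of the classification of graphs. *)
- move=> /packing_packed /(packed_good G_sym G_irr G_conn t_bd).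
  by move=> /(good_mengerian G_sym t_bd) /sym_iff.
- by move=> /sym_iff /mengerian_packed /(packed_good G_sym G_irr G_conn t_bd).
- by move=> /(good_mengerian G_sym t_bd) /mengerian_packed /packing_packed.
Qed.
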